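(* Let $d\ge3$ be an integer, $p_1,\dots,p_d\in(0,1)$, $J^d$ the first rencontre-time, and $\lambda_1,\lambda_2\in(0,1)$ arbitrary. Then, with the functions $UB$ and $LB$ defined in the context, $$E(J^d\mid J^d<\infty)\le\lim_{x\to1-}\frac{UB(x;\lambda_1\mid\varphi_d')}{LB(x;\lambda_2\mid\varphi_d)\left(1+LB(x;\lambda_2\mid\varphi_d)\right)},$$ $$E(J^d\mid J^d<\infty)\ge\lim_{x\to1-}\frac{LB(x;\lambda_2\mid\varphi_d')}{UB(x;\lambda_1\mid\varphi_d)\left(1+UB(x;\lambda_1\mid\varphi_d)\right)}.$$
   Context: Let $\{X^j_k\}_{k\ge1}$, $j=1,\dots,d$, be independent sequences, the $j$-th consisting of i.i.d. Bernoulli random variables with success parameter $p_j$ (all mutually independent); $S^j(n)=\sum_{i=1}^nX^j_i$; $J^d=\inf\{n\ge1:S^1(n)=\dots=S^d(n)\}$ ($\inf\emptyset=\infty$). Let $q_j=1-p_j$, $Q=\prod_jq_j$, $P=\prod_jp_jq_j^{-1}$, $T=Q(1+P^{1/d})^d$, and $r_n=Q^n\sum_{k=0}^n\binom nk^dP^k$ (the probability that $S^1(n)=\dots=S^d(n)$). With $[x]$ the greatest integer $\le x$, for $\alpha>0$, $\lambda\in(0,1)$ define $N(\alpha,\lambda)=\max\{[\alpha/\lambda]+1,[1/(\lambda\alpha)]+1\}$, $M(\alpha,\lambda)=\frac{\alpha+1}{\sqrt\alpha(1-\lambda)}$, $L(\alpha,\lambda)=\max\left\{\left[\left(\frac{(\alpha+1)+\sqrt{(\alpha+1)^2+4\lambda\alpha}}{2\lambda\alpha}\right)^2\right]+1,\left[\left(\frac{(\alpha+1)+\sqrt{(\alpha+1)^2+4\lambda\alpha}}{2\lambda}\right)^2\right]+1\right\}$,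 $C_1(\alpha,\lambda)=\max\left\{4,\frac{(\alpha+1)^2}{\alpha(1+\lambda\alpha)}\right\}\exp\!\left(-\frac12\frac{1+\lambda\alpha}{(1-\lambda)\alpha}\left((\alpha+1)^2+\frac{\lambda\alpha}{1+\lambda\alpha}\right)\right)$, $C_2(\alpha,\lambda)=\max\left\{4,\frac{(\alpha+1)^2}{\alpha+\lambda}\right\}\exp\!\left(-\frac12\frac{\alpha+\lambda}{(1-\lambda)\alpha^2}\left((\alpha+1)^2+\frac{\lambda\alpha^2}{\alpha+\lambda}\right)\right)$, $K(\alpha,d,\lambda)=\frac{(1-\lambda)\alpha+1}{\alpha+1}C_1^d+C_2^d$. Writing $N=N(P^{1/d},\lambda)$, $L=L(P^{1/d},\lambda)$, $M=M(P^{1/d},\lambda)$, $K=K(P^{1/d},d,\lambda)$, define for $0<x<1$: $UB(x;\lambda\mid\varphi_d)=\sum_{n=1}^{N-1}r_nx^n+\left(\frac{M}{\sqrt{2\pi}}\right)^{d-1}\sum_{n\ge N}n^{-\frac{d-1}{2}}(Tx)^n$; $LB(x;\lambda\mid\varphi_d)=\sum_{n=1}^{L-1}r_nx^n+\left(\frac{\sqrt{2\pi}}{e^2}\right)^dK\sum_{n\ge L}n^{-\frac{d-1}{2}}(Tx)^n$; $UB(x;\lambda\mid\varphi_d')=\sum_{n=1}^{N-1}nr_nx^{n-1}+\left(\frac{M}{\sqrt{2\pi}}\right)^{d-1}\sum_{n\ge N}n^{-\frac{d-3}{2}}x^{-1}(Tx)^n$; $LB(x;\lambda\mid\varphi_d')=\sum_{n=1}^{L-1}nr_nx^{n-1}+\left(\frac{\sqrt{2\pi}}{e^2}\right)^dK\sum_{n\ge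 L}n^{-\frac{d-3}{2}}x^{-1}(Tx)^n$. *)

(* Defs.v *)
From HB Require Import structures.
From mathcomp Require Import all_boot all_order all_algebra.
From mathcomp Require Import all_classical all_reals all_analysis.
Set Implicit Arguments. Unset Strict Implicit. Unset Printing Implicit Defensive.
Import Order.TTheory GRing.Theory Num.Theory.
Import numFieldNormedType.Exports.
Local Open Scope ring_scope.

Section Rencontre.
Variable R : realType.
Variable d : nat.
Variable p : 'I_d -> R.   (* success parameters p_1..p_d (index j-1) *)

(* An outcome of the first n trials of all d sequences: w (j, i) = X^{j+1}_{i+1}. *)
Definition outcome_weight n (w : {ffun 'I_d * 'I_n -> bool}) : R :=
  \prod_(ji : 'I_d * 'I_n) (if w ji then p ji.1 else 1 - p ji.1).

(* S^{j+1}(m) for m <= n, computed from the outcome w of the first n trials *)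
Definition partial_sum n (w : {ffun 'I_d * 'I_n -> bool}) (j : 'I_d) (m : nat) : nat :=
  \sum_(i < n | (i < m)%N) (w (j, i) : nat).

Definition all_equal_at n (w : {ffun 'I_d * 'I_n -> bool}) (m : nat) : bool :=
  [forall j : 'I_d, forall j' : 'I_d, partial_sum w j m == partial_sum w j' m].

Definition first_rencontre_at n (w : {ffun 'I_d * 'I_n -> bool}) : bool :=
  [&& (0 < n)%N, all_equal_at w n &
      [forall m : 'I_n, (0 < (m : nat))%N ==> ~~ all_equal_at w m]].

Definition prob_J (n : nat) : R :=
  \sum_(w : {ffun 'I_d * 'I_n -> bool} | first_rencontre_at w) outcome_weight w.

Definition prob_J_finite : R := limn (series prob_J).

Definition cond_mean_J : \bar R :=
  (\sum_(1 <= n <oo) ((n%:R * prob_J n / prob_J_finite)%:E))%E.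

Definition qq (j : 'I_d) : R := 1 - p j.
Definition QQ : R := \prod_(j < d) qq j.
Definition PP : R := \prod_(j < d) (p j / qq j).
Definition alpha : R := PP `^ (d%:R^-1).
Definition TT : R := QQ * (1 + alpha) ^+ d.
Definition rr (n : nat) : R :=
  QQ ^+ n * \sum_(k < n.+1) ('C(n, k))%:R ^+ d * PP ^+ k.

(* [x] + 1 for x > 0 (all arguments below are positive, so truncn x = [x]) *)
Definition Nbound (a l : R) : nat :=
  maxn (Num.truncn (a / l)).+1 (Num.truncn (1 / (l * a))).+1.
Definition Mbound (a l : R) : R := (a + 1) / (Num.sqrt a * (1 - l)).
Definition Lroot (a l : R) : R := (a + 1) + Num.sqrt ((a + 1) ^+ 2 + 4 * l * a).
Definition Lbound (a l : R) : nat :=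
  maxn (Num.truncn ((Lroot a l / (2 * l * a)) ^+ 2)).+1
       (Num.truncn ((Lroot a l / (2 * l)) ^+ 2)).+1.
Definition C1 (a l : R) : R :=
  Num.max 4 ((a + 1) ^+ 2 / (a * (1 + l * a))) *
  expR (- (1 / 2) * ((1 + l * a) / ((1 - l) * a)) *
        ((a + 1) ^+ 2 + l * a / (1 + l * a))).
Definition C2 (a l : R) : R :=
  Num.max 4 ((a + 1) ^+ 2 / (a + l)) *
  expR (- (1 / 2) * ((a + l) / ((1 - l) * a ^+ 2)) *
        ((a + 1) ^+ 2 + l * a ^+ 2 / (a + l))).
Definition Kconst (a : R) (dd : nat) (l : R) : R :=
  ((1 - l) * a + 1) / (a + 1) * C1 a l ^+ dd + C2 a l ^+ dd.

Definition tail_sum (m : nat) (u : nat -> R) : R :=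
  limn (fun k => \sum_(m <= n < k) u n).

Definition npow (n : nat) (e : R) : R := (n%:R) `^ (- e).

Definition UB_phi (x l : R) : R :=
  \sum_(1 <= n < Nbound alpha l) rr n * x ^+ n +
  (Mbound alpha l / Num.sqrt (2 * pi)) ^+ d.-1 *
  tail_sum (Nbound alpha l) (fun n => npow n ((d%:R - 1) / 2) * (TT * x) ^+ n).

Definition LB_phi (x l : R) : R :=
  \sum_(1 <= n < Lbound alpha l) rr n * x ^+ n +
  (Num.sqrt (2 * pi) / expR 2) ^+ d * Kconst alpha d l *
  tail_sum (Lbound alpha l) (fun n => npow n ((d%:R - 1) / 2) * (TT * x) ^+ n).

Definition UB_dphi (x l : R) : R :=
  \sum_(1 <= n < Nbound alpha l) n%:R * rr n * x ^+ n.-1 +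
  (Mbound alpha l / Num.sqrt (2 * pi)) ^+ d.-1 *
  tail_sum (Nbound alpha l)
    (fun n => npow n ((d%:R - 3) / 2) * x^-1 * (TT * x) ^+ n).

Definition LB_dphi (x l : R) : R :=
  \sum_(1 <= n < Lbound alpha l) n%:R * rr n * x ^+ n.-1 +
  (Num.sqrt (2 * pi) / expR 2) ^+ d * Kconst alpha d l *
  tail_sum (Lbound alpha l)
    (fun n => npow n ((d%:R - 3) / 2) * x^-1 * (TT * x) ^+ n).

End Rencontre.

(* Main.v *)
(** Since [J] is a renewal time, the generating functions [phi] of [rr] and [F] of [prob_J] satisfy
[phi = F * (1 + phi)], so that [F' / F = phi' / (phi * (1 + phi))] on [(0, 1)]; as [x] tends to [1]
from the left, [F' / F] tends to the conditional mean by monotone convergence. It therefore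
suffices to compare [rr] with the coefficients of [LB] and [UB], and to see that the two ratios
have limits.

With [a] the [d]-th root of [P], [rr n = T ^ n * sum_k b_k ^ d], where [b] is the binomial law with
odds [a]. Above, the sum is at most [(max b) ^ (d - 1)], and [max b] is bounded through
[C(k + m, k) ^ 2 k ^ (2 k + 1) m ^ (2 m + 1) / (k + m) ^ (2 (k + m) + 1) <= 1 / (2 pi)], which
follows from Wallis' bound on the diagonal by monotonicity in [k] and [m]. Below, by Chebyshev's
inequality at least [3 / 4] of the mass lies on at most [2 sqrt n + 1] values, and convexity of the
[d]-th power gives more than the constant [K] requires.

The limits exist because [T <= 1] (AM-GM): either the coefficients are summable, or [T = 1] and
[d = 3], where they are of order [1 / n] and both ratios tend to infinity. *)
Require Import Defs.
From HB Require Import structures.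
From mathcomp Require Import all_boot all_order all_algebra.
From mathcomp Require Import all_classical all_reals all_analysis.
From mathcomp Require Import ring lra zify.
Import Order.TTheory GRing.Theory Num.Theory.
Import numFieldNormedType.Exports.
Local Open Scope classical_set_scope.
Local Open Scope ring_scope.
Set Implicit Arguments.
Unset Strict Implicit.

(** * Wallis integrals and the central binomial coefficient *)

Fixpoint sin_antideriv (R : realType) (n : nat) (x : R) : R :=
  match n with
  | 0 => x
  | 1 => - cos x
  | m.+2 => (m.+1%:R * @sin_antideriv R m x - cos x * sin x ^+ m.+1) / m.+2%:R
  end.

Lemma is_derive_sin_antideriv (R : realType) (n : nat) (x : R) :
  is_derive x 1 (@sin_antideriv R n) (sin x ^+ n).
Proof.
(* The reduction formula reaches two exponents back, so consecutive exponents are treated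
   together. *)
suff H m : is_derive x 1 (@sin_antideriv R m) (sin x ^+ m) /\
    is_derive x 1 (@sin_antideriv R m.+1) (sin x ^+ m.+1) by have [] := H n.
elim: m => [|m [IH0 IH1]].
  split=> /=.
    by rewrite expr0; exact: is_derive_id.
  have -> : (fun y : R => - cos y) = - cos :> (R -> R) by apply/funext.
  by apply: is_derive_eq; rewrite expr1 opprK.
split=> //.
rewrite (_ : @sin_antideriv R m.+2 =
    m.+2%:R^-1 \*: (m.+1%:R \*: @sin_antideriv R m - cos * (sin ^+ m.+1))); last first.
  apply/funext => y /=; rewrite mulrC; congr (_ * (_ - _)).
  by rewrite /GRing.mul/= fctE.
apply: is_derive_eq; rewrite /= !fctE /GRing.scale /=.
have m2 : m.+2%:R != 0 :> R by rewrite pnatr_eq0.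
have c2 : cos x ^+ 2 = 1 - sin x ^+ 2 by rewrite -(cos2Dsin2 x) addrK.
apply: (mulfI m2); rewrite mulVKf//.
transitivity (m.+1%:R * sin x ^+ m * (1 - cos x ^+ 2) + sin x ^+ m.+2).
  by rewrite !exprS; ring.
by rewrite c2 !exprS -[m.+2%:R]natr1; ring.
Qed.

(** Both sides are Wallis integrals, written as differences of primitives. As sin^(n+1) <= sin^n on
    [0, pi/2], the mean value theorem for the difference of the two primitives compares them. *)
Lemma sin_antideriv_le (R : realType) (n : nat) :
  @sin_antideriv R n.+1 (pi / 2) - @sin_antideriv R n.+1 0 <=
  @sin_antideriv R n (pi / 2) - @sin_antideriv R n 0.
Proof.
have p2 : 0 <= pi / 2 :> R by rewrite divr_ge0 ?pi_ge0.
have D (x : R) : is_derive x 1 (@sin_antideriv R n - @sin_antideriv R n.+1)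
    (sin x ^+ n - sin x ^+ n.+1).
  by apply: is_deriveB; exact: is_derive_sin_antideriv.
have [|c cI] := @MVT_segment R _ _ _ _ p2 (fun x _ => D x).
  apply: derivable_within_continuous => x _.
  by apply: ex_derive; exact: D.
rewrite !fctE => E.
suff : 0 <= (sin c ^+ n - sin c ^+ n.+1) * (pi / 2 - 0) by rewrite -E; lra.
apply: mulr_ge0; last by rewrite subr0.
rewrite subr_ge0 exprS ler_piMl ?sin_le1// exprn_ge0//.
rewrite sin_ge0_pi// (itvP cI)/=.
move: cI; rewrite in_itv/= => /andP[_ /le_trans]; apply.
by have := pi_ge0 R; lra.
Qed.

(** Wallis' argument: the even integral is a multiple of the central binomial coefficient, the odd
    one a multiple of its inverse, and the integrals decrease in the exponent. *)
Lemma central_bin_le (R : realType) (n : nat) : (0 < n)%N ->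
  pi * n%:R * 'C(n.*2, n)%:R ^+ 2 <= (16 : R) ^+ n.
Proof.
pose W m := @sin_antideriv R m (pi / 2) - @sin_antideriv R m 0.
have WS m : W m.+2 = m.+1%:R / m.+2%:R * W m.
  rewrite /W /= cos_pihalf sin0 !exprS; field.
  by apply: lt0r_neq0; have := ler0n R m; lra.
have W0 : W 0%N = pi / 2 by rewrite /W /= subr0.
have W1 : W 1%N = 1 by rewrite /W /= cos_pihalf cos0; lra.
have binS m : 'C(m.+1.*2, m.+1)%:R * m.+1%:R = 2 * m.*2.+1%:R * 'C(m.*2, m)%:R :> R.
  rewrite -!natrM; congr (_%:R).
  have := mul_bin_diag m.*2.+2 m; have := mul_bin_down m.*2.+1 m.
  rewrite /= doubleS (_ : (m.*2.+1 - m = m.+1)%N); lia.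
have We m : W m.*2 * 4 ^+ m = pi / 2 * 'C(m.*2, m)%:R.
  elim: m => [|m IH]; first by rewrite double0 bin0 W0 !mulr1.
  have m1 : m.+1%:R != 0 :> R by rewrite pnatr_eq0.
  apply: (mulIf m1); rewrite -[RHS]mulrA binS doubleS WS.
  have -> : m.*2.+2%:R = 2 * m.+1%:R :> R by rewrite -natrM mul2n.
  rewrite !exprS.
  transitivity (m.*2.+1%:R * 2 * (W m.*2 * 4 ^+ m)).
    by field; apply: lt0r_neq0; have := ler0n R m; lra.
  by rewrite IH; ring.
have Wo m : W m.*2.+1 * (m.*2.+1%:R * 'C(m.*2, m)%:R) = 4 ^+ m.
  elim: m => [|m IH]; first by rewrite double0 bin0 W1 !mulr1.
  have m1 : m.+1%:R != 0 :> R by rewrite pnatr_eq0.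
  have m3 : m.*2.+3%:R != 0 :> R by rewrite pnatr_eq0.
  apply: (mulIf m1); rewrite -!mulrA binS doubleS WS.
  have -> : m.*2.+2%:R = 2 * m.+1%:R :> R by rewrite -natrM mul2n.
  rewrite !exprS -IH; field.
  by apply: lt0r_neq0; have := ler0n R m; rewrite -?muln2 ?natrM; lra.
case: n => // n _.
have := sin_antideriv_le R n.*2.+1; rewrite -/(W _) -/(W _) -doubleS => Wle.
have C0 : 0 < 'C(n.+1.*2, n.+1)%:R :> R by rewrite ltr0n bin_gt0 -addnn leq_addr.
have K0 : 0 < n.+1%:R :> R by rewrite ltr0n.
have F0 : 0 < 4 ^+ n.+1 :> R by rewrite exprn_gt0.
have E1 := We n.+1.
have E2 : W n.*2.+1 * ('C(n.+1.*2, n.+1)%:R * n.+1%:R) = 4 ^+ n.+1 / 2.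
  rewrite binS exprS -[in RHS]Wo; set y := W _.
  by field.
have : W n.+1.*2 * ('C(n.+1.*2, n.+1)%:R * n.+1%:R) * 4 ^+ n.+1 <=
    W n.*2.+1 * ('C(n.+1.*2, n.+1)%:R * n.+1%:R) * 4 ^+ n.+1.
  by rewrite ler_pM2r// ler_pM2r// mulr_gt0.
rewrite E2 -mulrA [_ * 4 ^+ _]mulrC mulrA E1.
have -> : 16 = 4 ^+ 2 :> R by ring.
by rewrite -exprM mulnC exprM; nra.
Qed.

(** * A Stirling-type bound for binomial coefficients *)

Lemma bernoulli3 (R : realFieldType) (z : R) (n : nat) : 0 <= z ->
  1 + n%:R * z + n%:R * (n%:R - 1) / 2 * z ^+ 2 +
  n%:R * (n%:R - 1) * (n%:R - 2) / 6 * z ^+ 3 <= (1 + z) ^+ n.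
Proof.
move=> z0; elim: n => [|n IH]; first by rewrite expr0 !mul0r !addr0.
(* The surplus of the induction step is C(n, 3) z^4, so this coefficient must be nonnegative; for n
   = 0 and n = 1 a factor is zero. *)
have n3 : 0 <= n%:R * (n%:R - 1) * (n%:R - 2) :> R.
  case: n {IH} => [|[|n]]; [by rewrite !mul0r|by rewrite subrr mulr0 mul0r|].
  by rewrite !mulr_ge0// subr_ge0 ?ler1n ?ler_nat.
rewrite [leRHS]exprS; apply: le_trans (ler_wpM2l _ IH); last by rewrite addr_ge0.
have z4 : 0 <= n%:R * (n%:R - 1) * (n%:R - 2) * z ^+ 4.
  by rewrite mulr_ge0// exprn_ge0.
rewrite -natr1 -subr_ge0; apply: le_trans (divr_ge0 z4 (ler0n R 6)) _.
by rewrite le_eqVlt; apply/orP; left; apply/eqP; field.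
Qed.

(** A sequence decreasing to e^2; consecutive values of [bin_peak] differ by a quotient of two of
    its terms. *)
Definition stirling_ratio (R : realFieldType) (k : nat) : R :=
  (k.+1%:R / k%:R) ^+ k.*2.+1.

Lemma stirling_ratioS_le (R : realFieldType) (k : nat) : (0 < k)%N ->
  stirling_ratio R k.+1 <= stirling_ratio R k.
Proof.
move=> k0; rewrite /stirling_ratio doubleS.
set x : R := k%:R; have x1 : 1 <= x by rewrite ler1n.
rewrite -![_.+1%:R]natr1 -/x.
have y0 : 0 < (x + 1 + 1) / (x + 1) by rewrite divr_gt0//; lra.
(* This z satisfies 1 + 1/x = (1 + z)(1 + 1/(x + 1)); after cancelling, (1 + z)^(2x + 1) >= (1 +
   1/(x + 1))^2 remains. *)
pose z := 1 / (x * (x + 2)).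
have z0 : 0 <= z by rewrite divr_ge0// mulr_ge0//; lra.
have -> : (x + 1) / x = (1 + z) * ((x + 1 + 1) / (x + 1)).
  by rewrite /z; field; apply/and3P; split; apply: lt0r_neq0; lra.
set y := (x + 1 + 1) / (x + 1) in y0 *.
rewrite [leRHS]exprMn -addn2 [leLHS]exprD [leLHS]mulrC ler_pM2r ?exprn_gt0//.
(* The third order matters: its term contributes (4x^2 - 1)(x + 1)^2 to the numerator below, and
   without it the difference is negative from x = 3 on. *)
apply: (le_trans _ (@bernoulli3 R z k.*2.+1 z0)).
rewrite -natr1 -mul2n natrM -/x.
rewrite -subr_ge0 /z /y.
have -> : 1 + (2 * x + 1) * (1 / (x * (x + 2))) +
 (2 * x + 1) * (2 * x + 1 - 1) / 2 * (1 / (x * (x + 2))) ^+ 2 +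
 (2 * x + 1) * (2 * x + 1 - 1) * (2 * x + 1 - 2) / 6 *
 (1 / (x * (x + 2))) ^+ 3 - ((x + 1 + 1) / (x + 1)) ^+ 2 =
 ((4 * x ^+ 2 - 1) * (x + 1) ^+ 2 - 3 * x * (x ^+ 2 - x - 3) * (x + 2)) /
  (3 * x ^+ 2 * (x + 2) ^+ 3 * (x + 1) ^+ 2).
  by field; apply/and3P; split; apply: lt0r_neq0; lra.
apply: divr_ge0; first by nra.
by rewrite !mulr_ge0 ?exprn_ge0//; lra.
Qed.

Lemma stirling_ratio_le (R : realFieldType) (k m : nat) : (0 < k)%N ->
  stirling_ratio R (k + m) <= stirling_ratio R k.
Proof.
move=> k0; elim: m => [|m IH]; first by rewrite addn0.
rewrite addnS (le_trans _ IH)// stirling_ratioS_le//.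
by rewrite (leq_trans k0) ?leq_addr.
Qed.

(** The squared probability of k successes in k + m trials with success parameter k/(k + m), times
    the variance km/(k + m). *)
Definition bin_peak (R : realFieldType) (k m : nat) : R :=
  'C(k + m, k)%:R ^+ 2 * k%:R ^+ k.*2.+1 * m%:R ^+ m.*2.+1 /
  (k + m)%:R ^+ (k + m).*2.+1.

Lemma bin_peakC (R : realFieldType) (k m : nat) :
  bin_peak R k m = bin_peak R m k.
Proof.
rewrite /bin_peak [(m + k)%N]addnC.
by rewrite -(bin_sub (leq_addl k m)) addnK; congr (_ / _); ring.
Qed.

(** The quotient of the two sides is [stirling_ratio R k / stirling_ratio R (k + m)], at least 1
    because that sequence decreases. *)
Lemma bin_peakS (R : realFieldType) (k m : nat) : (0 < k)%N ->
  bin_peak R k m <= bin_peak R k.+1 m.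
Proof.
move=> k0.
have kR : 0 < k%:R :> R by rewrite ltr0n.
have k1R : 0 < k.+1%:R :> R by rewrite ltr0n.
have nR : 0 < (k + m)%:R :> R by rewrite ltr0n addn_gt0 k0.
have n1R : 0 < (k + m).+1%:R :> R by rewrite ltr0n.
have B0 : 0 <= bin_peak R k m by rewrite divr_ge0 ?mulr_ge0 ?exprn_ge0.
have C1 : 'C(k.+1 + m, k.+1)%:R = (k + m).+1%:R / k.+1%:R * 'C(k + m, k)%:R :> R.
  apply: (mulfI (lt0r_neq0 k1R)); rewrite mulrA mulrCA divff ?lt0r_neq0// mulr1.
  by rewrite -!natrM addSn mul_bin_diag.
have -> : bin_peak R k.+1 m =
    stirling_ratio R k / stirling_ratio R (k + m) * bin_peak R k m.
  rewrite /bin_peak C1 /stirling_ratio addSn !doubleS !expr_div_n !exprS.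
  field.
  by rewrite -natrD !nat1r !expf_neq0 ?lt0r_neq0.
rewrite ler_peMl// ler_pdivlMr ?mul1r ?stirling_ratio_le//.
by rewrite exprn_gt0// divr_gt0.
Qed.

Lemma bin_peak_le (R : realType) (k m : nat) : (0 < k)%N -> (0 < m)%N ->
  bin_peak R k m <= (2 * pi)^-1.
Proof.
have mono k' m' i : (0 < k')%N -> bin_peak R k' m' <= bin_peak R (k' + i) m'.
  move=> k0; elim: i => [|i IH]; first by rewrite addn0.
  rewrite (le_trans IH)// addnS bin_peakS//.
  by rewrite (leq_trans k0) ?leq_addr.
(* By symmetry the smaller argument can be raised to the larger one; on the diagonal the claim is pi
   m C(2m, m)^2 <= 16^m. *)
wlog km : k m / (k <= m)%N.
  move=> H k0 m0; case: (leqP k m) => [km|/ltnW mk]; first exact: H.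
  by rewrite bin_peakC H.
move=> k0 m0; apply: le_trans (mono _ _ (m - k)%N k0) _.
rewrite subnKC// /bin_peak.
have m0R : 0 < m%:R :> R by rewrite ltr0n.
rewrite (_ : (m + m)%:R = 2 * m%:R :> R); last by rewrite natrD; ring.
rewrite exprMn -[_ ^+ 2 * _ * _]mulrA -exprD.
rewrite (_ : (m.*2.+1 + m.*2.+1 = (m + m).*2.+2)%N); last by lia.
rewrite ler_pdivrMr ?mulr_gt0 ?exprn_gt0// ler_pdivlMl ?mulr_gt0 ?pi_gt0//.
rewrite [_ ^+ _.+2]exprS !mulrA ler_pM2r; last exact: (exprn_gt0 (m + m).*2.+1 m0R).
rewrite (_ : (2 : R) ^+ (m + m).*2.+1 = 2 * 16 ^+ m); last first.
  have -> : 16 = 2 ^+ 4 :> R by ring.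
  by rewrite -exprM exprS; congr (_ * _ ^+ _); lia.
have := central_bin_le R m0; rewrite -addnn; lra.
Qed.

(** * Upper bound for the maximum of a binomial law *)

Definition odds_pmf (R : realFieldType) (a : R) (n k : nat) : R :=
  'C(n, k)%:R * a ^+ k / (1 + a) ^+ n.

Lemma odds_pmf_ge0 (R : realFieldType) (a : R) (n k : nat) :
  0 <= a -> 0 <= odds_pmf a n k.
Proof.
by move=> a0; rewrite divr_ge0 ?mulr_ge0 ?exprn_ge0// addr_ge0.
Qed.

Lemma sum_odds_pmf (R : realFieldType) (a : R) (n : nat) :
  0 <= a -> \sum_(k < n.+1) odds_pmf a n k = 1.
Proof.
move=> a0; rewrite -mulr_suml.
rewrite (_ : \sum_(k < n.+1) _ = (1 + a) ^+ n) ?divff ?expf_neq0//.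
  by rewrite lt0r_neq0// ltr_wpDr.
rewrite exprDn; apply: eq_bigr => k _.
by rewrite expr1n mul1r mulr_natl.
Qed.

(** As a function of a the probability is largest at a = k/m, where its square is [bin_peak R k m]
    times (k + m)/(km). *)
Lemma odds_pmf_sqr_le (R : realType) (a : R) (k m : nat) :
  0 < a -> (0 < k)%N -> (0 < m)%N ->
  odds_pmf a (k + m) k ^+ 2 <= (2 * pi)^-1 * ((k + m)%:R / (k%:R * m%:R)).
Proof.
move=> a0 k0 m0.
have kR : 0 < k%:R :> R by rewrite ltr0n.
have mR : 0 < m%:R :> R by rewrite ltr0n.
have nR : 0 < (k + m)%:R :> R by rewrite ltr0n addn_gt0 k0.
have a1 : 0 < 1 + a by rewrite addr_gt0.
(* x and y compare the parameters a/(1 + a) and 1/(1 + a) with the frequencies of k and m. From z^j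
   <= exp(j (z - 1)) and k (x - 1) + m (y - 1) = 0 follows x^k y^m <= 1. *)
pose x := (k + m)%:R * a / ((1 + a) * k%:R).
pose y := (k + m)%:R / ((1 + a) * m%:R).
have x0 : 0 <= x by rewrite divr_ge0 ?mulr_ge0 ?ltW.
have y0 : 0 <= y by rewrite divr_ge0 ?mulr_ge0 ?ltW.
have xy : x ^+ k * y ^+ m <= 1.
  have le_exp z j : 0 <= z -> z ^+ j <= expR (j%:R * (z - 1)).
    move=> z0; rewrite mulrC expRM_natr lerXn2r ?nnegrE ?expR_ge0//.
    by have := expR_ge1Dx (z - 1); lra.
  apply: (@le_trans _ _ (expR (k%:R * (x - 1)) * expR (m%:R * (y - 1)))).
    by apply: ler_pM; rewrite ?exprn_ge0 ?le_exp.
  rewrite -expRD (_ : _ + _ = 0) ?expR0// /x /y natrD; field.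
  by rewrite !lt0r_neq0.
have xyE : x ^+ k * y ^+ m =
    a ^+ k / (1 + a) ^+ (k + m) * ((k + m)%:R ^+ (k + m) / (k%:R ^+ k * m%:R ^+ m)).
  rewrite /x /y !expr_div_n !exprMn !exprD; field.
  by rewrite !expf_neq0 ?lt0r_neq0.
pose D := k%:R ^+ k * m%:R ^+ m / (k + m)%:R ^+ (k + m) : R.
have D0 : 0 < D by rewrite divr_gt0 ?mulr_gt0 ?exprn_gt0.
have pE : odds_pmf a (k + m) k = x ^+ k * y ^+ m * ('C(k + m, k)%:R * D).
  rewrite xyE /odds_pmf /D; field.
  by rewrite !expf_neq0 ?lt0r_neq0.
have pD : odds_pmf a (k + m) k <= 'C(k + m, k)%:R * D.
  by rewrite pE ler_piMl// mulr_ge0// ltW.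
apply: (@le_trans _ _ (('C(k + m, k)%:R * D) ^+ 2)).
  by rewrite lerXn2r// nnegrE ?odds_pmf_ge0 ?mulr_ge0// ltW.
rewrite (_ : _ ^+ 2 = bin_peak R k m * ((k + m)%:R / (k%:R * m%:R))).
  by rewrite ler_wpM2r ?bin_peak_le// divr_ge0 ?mulr_ge0.
rewrite /bin_peak /D -!mul2n !exprS !exprM ![_ ^+ 2 ^+ _]exprAC.
set K := k%:R ^+ k; set M := m%:R ^+ m; set N := (k + m)%:R ^+ (k + m).
have N0 : 0 < N by rewrite exprn_gt0.
have := nR; set s := (k + m)%:R; rewrite !expr0 => s0.
clearbody K M N s; field.
by rewrite !lt0r_neq0.
Qed.

(** It suffices to bound the law at a mode k0, where both k0 and n - k0 are at least proportional to
    n. *)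
Lemma odds_pmf_le (R : realType) (a l : R) (n k : nat) :
  0 < a -> 0 < l < 1 -> (Nbound a l <= n)%N -> (k <= n)%N ->
  odds_pmf a n k <= Mbound a l / Num.sqrt (2 * pi) / Num.sqrt n%:R.
Proof.
move=> a0 /andP[l0 l1] Nn kn.
have a1 : 0 < 1 + a by rewrite addr_gt0.
have [k0 k0n kmax] : exists2 k0, (k0 <= n)%N &
    forall j, (j <= n)%N -> odds_pmf a n j <= odds_pmf a n k0.
  case: (@Order.TotalTheory.arg_maxP _ _ _ (@ord0 n) xpredT (fun i : 'I_n.+1 => odds_pmf a n i)) => // k0 _ H.
  exists (nat_of_ord k0) => [|j jn]; first by case: k0 {H}.
  by have := H (inord j) isT; rewrite inordK.
apply: (le_trans (kmax k kn)) => {k kn}.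
have pmf_le i j : odds_pmf a n i <= odds_pmf a n j ->
    'C(n, i)%:R * a ^+ i <= 'C(n, j)%:R * a ^+ j.
  by rewrite /odds_pmf ler_pM2r// invr_gt0 exprn_gt0.
have [m nE] : exists m, n = (k0 + m)%N.
  by exists (n - k0)%N; rewrite subnKC.
(* The two entries of [Nbound] give n l > a and n l a > 1, which absorb the rounding of the mode. *)
have na : a < n%:R * l.
  rewrite -ltr_pdivrMr//.
  have := truncnS_gt (a / l); move=> /lt_le_trans; apply.
  by rewrite ler_nat (leq_trans _ Nn)// leq_maxl.
have nla : 1 < n%:R * (l * a).
  rewrite -ltr_pdivrMr ?mulr_gt0//.
  have := truncnS_gt (1 / (l * a)); move=> /lt_le_trans; apply.
  by rewrite ler_nat (leq_trans _ Nn)// leq_maxr.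
(* The mode beats its right neighbour here and its left neighbour in [dn]; where the neighbour is
   missing, the inequality is trivial. *)
have up : m%:R * a <= k0%:R + 1.
  case: m nE => [|m] nE; first by rewrite mul0r.
  have := pmf_le _ _ (kmax k0.+1 _); rewrite exprS mulrA ler_pM2r ?exprn_gt0//.
  rewrite nE addnS ltnS leq_addr => /(_ isT).
  rewrite -(@ler_pM2l _ k0.+1%:R)// mulrA -natrM mul_bin_left -addnS addKn natrM.
  rewrite natr1 mulrAC ler_pM2r// ltr0n bin_gt0 leq_addr//.
have dn : k0%:R <= (m%:R + 1) * a.
  case: k0 nE kmax {k0n up} => [|k] nE kmax.
    by rewrite mulr_ge0 ?ltW// ltr_wpDl.
  have := pmf_le _ _ (kmax k _); rewrite exprS mulrA ler_pM2r ?exprn_gt0//.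
  rewrite nE addSnnS leq_addr => /(_ isT).
  rewrite -(@ler_pM2l _ k.+1%:R)// mulrA -[X in _ <= X * _]natrM mul_bin_left.
  rewrite [in (_ - k)%N]addnC addnK natrM natr1 [X in _ <= X -> _]mulrAC.
  by rewrite ler_pM2r// ltr0n bin_gt0 leq_addr.
have nR : n%:R = k0%:R + m%:R :> R by rewrite nE natrD.
have n0 : 0 < n%:R :> R.
  by rewrite lt_neqAle eq_sym ler0n andbT; apply/eqP => n0; rewrite n0 in na; lra.
have l1' : 0 < 1 - l by rewrite subr_gt0.
have xR : n%:R * a * (1 - l) <= k0%:R * (1 + a) by rewrite nR in nla *; lra.
have yR : n%:R * (1 - l) <= m%:R * (1 + a) by rewrite nR in na *; lra.
have x0 : 0 < k0%:R :> R.
  by rewrite -(pmulr_lgt0 _ a1); apply: lt_le_trans xR; rewrite !mulr_gt0.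
have y0 : 0 < m%:R :> R.
  by rewrite -(pmulr_lgt0 _ a1); apply: lt_le_trans yR; rewrite !mulr_gt0.
have sa : 0 < Num.sqrt a by rewrite sqrtr_gt0.
have p0 : 0 < 2 * pi :> R by rewrite mulr_gt0 ?pi_gt0.
have sp : 0 < Num.sqrt (2 * pi) :> R by rewrite sqrtr_gt0.
have sn : 0 < Num.sqrt n%:R :> R by rewrite sqrtr_gt0.
have M0 : 0 <= Mbound a l / Num.sqrt (2 * pi) / Num.sqrt n%:R.
  by rewrite /Mbound ltW// !divr_gt0 ?mulr_gt0// addr_gt0.
rewrite -ler_sqr ?nnegrE ?odds_pmf_ge0 ?(ltW a0)//.
have := @odds_pmf_sqr_le R a k0 m a0; rewrite -nE -!(ltr0n R).
move=> /(_ x0 y0)/le_trans; apply.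
rewrite /Mbound !expr_div_n exprMn !sqr_sqrtr ?(ltW a0) ?(ltW p0) ?(ltW n0)//.
rewrite [leRHS]mulrAC [leRHS]mulrC ler_pM2l ?invr_gt0//.
rewrite ler_pdivrMr ?mulr_gt0// mulrC mulrA ler_pdivlMr//.
rewrite mulrA ler_pdivlMr ?mulr_gt0 ?exprn_gt0//.
(* The product of [xR] and [yR] is n^2 a (1 - l)^2 <= k0 m (1 + a)^2, which bounds n/(k0 m) by the
   square of [Mbound a l] over n. *)
have h1 : 0 <= n%:R * a * (1 - l) by rewrite ltW// !mulr_gt0.
have h2 : 0 <= n%:R * (1 - l) by rewrite ltW// !mulr_gt0.
have := ler_pM h1 h2 xR yR; rewrite !expr2; lra.
Qed.

(** * Lower bound for power sums of a binomial law *)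

Lemma sum_binS (R : comRingType) (n : nat) (g : nat -> R) :
  \sum_(k < n.+2) 'C(n.+1, k)%:R * g k =
  \sum_(k < n.+1) 'C(n, k)%:R * g k + \sum_(k < n.+1) 'C(n, k)%:R * g k.+1.
Proof.
rewrite big_ord_recl bin0.
under eq_bigr => k _ do rewrite lift0 binS natrD mulrDl.
rewrite big_split addrA; congr (_ + _).
rewrite [RHS]big_ord_recl bin0; congr (_ + _).
by rewrite big_ord_recr /= bin_small// mul0r addr0.
Qed.

(** On the right stand the variance and the squared distance from the mean to c. The induction by
    Pascal's rule shifts the centre to c - 1, hence the general c. *)
Lemma sum_bin_sqr (R : fieldType) (a c : R) (n : nat) : 1 + a != 0 ->
  \sum_(k < n.+1) 'C(n, k)%:R * (a ^+ k * (k%:R - c) ^+ 2) =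
  (1 + a) ^+ n * (n%:R * a / (1 + a) ^+ 2 + (n%:R * a / (1 + a) - c) ^+ 2).
Proof.
move=> a1; elim: n c => [|n IH] c.
  by rewrite big_ord1 /= bin0 !expr0 !mul1r !mul0r !add0r.
rewrite (sum_binS n (fun k => a ^+ k * (k%:R - c) ^+ 2)) IH.
have -> : \sum_(k < n.+1) 'C(n, k)%:R * (a ^+ k.+1 * (k.+1%:R - c) ^+ 2) =
    a * \sum_(k < n.+1) 'C(n, k)%:R * (a ^+ k * (k%:R - (c - 1)) ^+ 2).
  rewrite mulr_sumr; apply: eq_bigr => k _.
  by rewrite -natr1 exprS; ring.
by rewrite IH [_ ^+ n.+1]exprS -natr1; field.
Qed.

(** The subtraction truncates, so only pairs with i <= j restrict A; all of A lies between its least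
    and its greatest element. *)
Lemma card_window (R : realFieldType) (n : nat) (A : {set 'I_n}) (w : R) :
  0 <= w -> (forall i j, i \in A -> j \in A -> (j - i)%:R <= w) ->
  #|A|%:R <= w + 1.
Proof.
move=> w0 Aw; have [->|[i0 i0A]] := set_0Vmem A.
  by rewrite cards0 mulr0n addr_ge0.
have [i iA imin] := @arg_minnP _ i0 (mem A) (@nat_of_ord n) i0A.
have [j jA jmax] := @arg_maxnP _ i0 (mem A) (@nat_of_ord n) i0A.
have ij : (i <= j)%N by apply: imin.
have : (#|A| <= (j - i).+1)%N.
  rewrite cardE -(size_map val) -(size_iota i (j - i).+1).
  apply: uniq_leq_size; first by rewrite (map_inj_uniq val_inj) enum_uniq.
  move=> _ /mapP[k + ->]; rewrite mem_enum mem_iota => kA.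
  by rewrite imin//= addnS subnKC// ltnS; exact: jmax.
rewrite -(ler_nat R) => /le_trans; apply.
by rewrite -natr1 lerD2r Aw.
Qed.

(** Convexity: the left side is the tangent at m. The surplus of the induction step is (d + 1) m^d
    (x - m)^2. *)
Lemma exprn_tangent (R : realFieldType) (x m : R) (d : nat) :
  0 <= x -> 0 <= m ->
  d.+1%:R * m ^+ d * x - d%:R * m ^+ d.+1 <= x ^+ d.+1.
Proof.
move=> x0 m0; elim: d => [|d IH]; first by rewrite !expr0 expr1; lra.
rewrite [leRHS]exprS; apply: le_trans (ler_wpM2l x0 IH).
have h : 0 <= d.+1%:R * m ^+ d * (x - m) ^+ 2.
  by rewrite mulr_ge0 ?sqr_ge0// mulr_ge0 ?exprn_ge0.
by move: h; rewrite !exprS -!natr1; lra.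
Qed.

Lemma sum_odds_pmf_expr_ge (R : realType) (a : R) (n d : nat) :
  0 < a -> (4 <= n)%N ->
  3 / 4 * (3 / 10 / Num.sqrt n%:R) ^+ d <=
  \sum_(k < n.+1) odds_pmf a n k ^+ d.+1.
Proof.
move=> a0 n4; set w := Num.sqrt n%:R.
have a1 : 0 < 1 + a by rewrite addr_gt0.
have w2 : w ^+ 2 = n%:R by rewrite sqr_sqrtr.
have w_ge2 : 2 <= w.
  rewrite -ler_sqr ?nnegrE ?sqrtr_ge0// w2 -natrX ler_nat.
  exact: n4.
have w0 : 0 < w by apply: lt_le_trans w_ge2.
pose c := n%:R * a / (1 + a).
pose A := [set k : 'I_n.+1 | `|k%:R - c| < w]%SET.
have cardA : #|A|%:R <= 2 * w + 1.
  apply: card_window => [|i j]; first by rewrite mulr_ge0// ltW.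
  rewrite !inE !ltr_norml => /andP[i1 i2] /andP[j1 j2].
  case: (leqP i j) => ij; first by rewrite natrB//; lra.
  by move/ltnW: ij; rewrite -subn_eq0 => /eqP ->; rewrite mulr_ge0// ltW.
(* Chebyshev's inequality with radius sqrt n: the variance is n a/(1 + a)^2 <= n/4. *)
have massA : 3 / 4 <= \sum_(k in A) odds_pmf a n k.
  have := sum_odds_pmf n (ltW a0); rewrite (bigID (mem A))/= => E.
  suff : \sum_(k < n.+1 | k \notin A) odds_pmf a n k <= 1 / 4.
    by move=> h; move: E; set s := \sum_(_ in _) _; set t := \sum_(_ < _ | _) _ in h *; lra.
  apply: (@le_trans _ _ (\sum_(k < n.+1) odds_pmf a n k * ((k%:R - c) ^+ 2 / n%:R))).
    rewrite big_mkcond; apply: ler_sum => k _.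
    have p0 := odds_pmf_ge0 n k (ltW a0).
    rewrite inE -leNgt; case: ifP => [kA|_].
      rewrite ler_peMr// -w2 -expr_div_n -[leRHS]real_normK ?num_real//.
      by rewrite normrM normfV (gtr0_norm w0) exprn_ege1// ler_pdivlMr// mul1r.
    by rewrite mulr_ge0// divr_ge0// sqr_ge0.
  have -> : \sum_(k < n.+1) odds_pmf a n k * ((k%:R - c) ^+ 2 / n%:R) =
     (\sum_(k < n.+1) 'C(n, k)%:R * (a ^+ k * (k%:R - c) ^+ 2)) /
       ((1 + a) ^+ n * n%:R).
    rewrite mulr_suml; apply: eq_bigr => k _; rewrite /odds_pmf invfM.
    by ring.
  rewrite sum_bin_sqr ?lt0r_neq0// subrr expr0n addr0.
  have n0 : n%:R != 0 :> R by rewrite pnatr_eq0 -lt0n (leq_trans _ n4).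
  rewrite (_ : _ / _ = a / (1 + a) ^+ 2); last first.
    by field; rewrite ?n0 ?expf_neq0 ?(lt0r_neq0 a1).
  rewrite ler_pdivrMr ?exprn_gt0//.
  by have := sqr_ge0 (1 - a); lra.
(* The tangent point lies below the average mass on A: by [cardA] and w >= 2, m |A| <= (3/10)(2w +
   1)/w <= 3/4. Summing the tangents leaves (d + 1 - d) (3/4) m^d. *)
set m := 3 / 10 / w.
have m0 : 0 < m by rewrite divr_gt0.
apply: (@le_trans _ _ (\sum_(k in A) odds_pmf a n k ^+ d.+1)); last first.
  rewrite [leRHS](bigID (mem A))/= lerDl sumr_ge0// => k _.
  by rewrite exprn_ge0// odds_pmf_ge0 ?ltW.
apply: (@le_trans _ _ (\sum_(k in A)
    (d.+1%:R * m ^+ d * odds_pmf a n k - d%:R * m ^+ d.+1))); last first.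
  by apply: ler_sum => k _; apply: exprn_tangent; rewrite ?odds_pmf_ge0 ?ltW.
rewrite sumrB -mulr_sumr sumr_const -mulr_natl.
have h1 : d.+1%:R * m ^+ d * (3 / 4) <=
    d.+1%:R * m ^+ d * \sum_(k in A) odds_pmf a n k.
  by rewrite ler_wpM2l// mulr_ge0// exprn_ge0// ltW.
have mA : m * #|A|%:R <= 3 / 4.
  rewrite (le_trans (ler_wpM2l (ltW m0) cardA))// /m mulrAC ler_pdivrMr//.
  by lra.
have h2 : #|A|%:R * (d%:R * m ^+ d.+1) <= d%:R * m ^+ d * (3 / 4).
  rewrite exprS (_ : _ * _ = d%:R * m ^+ d * (m * #|A|%:R)); last by ring.
  by rewrite ler_wpM2l// mulr_ge0// exprn_ge0// ltW.
rewrite -natr1 in h1 *; lra.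
Qed.

(** * The constants K and L *)

Lemma expR4_ge (R : realType) : 40 <= expR 4 :> R.
Proof.
have h : (9 / 8) ^+ 32 <= expR 4 :> R.
  rewrite (_ : 4 = 1 / 8 * 32%:R); last by lra.
  rewrite expRM_natr lerXn2r// ?nnegrE ?expR_ge0//.
  by have := expR_ge1Dx (1 / 8 : R); lra.
apply: le_trans h.
(* Repeated squaring with rounding down: (9/8)^2, (9/8)^4, (9/8)^8 and (9/8)^16 are at least 1.265,
   1.6, 2.56 and 6.5, and 6.5^2 > 40. *)
have e2 (x y : R) i : 0 <= x -> x <= (9 / 8) ^+ i -> y <= x ^+ 2 ->
    y <= (9 / 8) ^+ (i * 2).
  move=> x0 xi /le_trans; apply; rewrite exprM.
  by apply: lerXn2r; rewrite ?nnegrE ?exprn_ge0 ?divr_ge0.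
apply: (e2 (65 / 10) _ 16%N); [by lra| |by lra].
apply: (e2 (256 / 100) _ 8%N); [by lra| |by lra].
apply: (e2 (16 / 10) _ 4%N); [by lra| |by lra].
apply: (e2 (1265 / 1000) _ 2%N); [by lra| |by lra].
by lra.
Qed.

(** With u = (a + 1)^2/a >= 4, both [C1] and [C2] are at most u exp(-u/2), and this is at most 4
    exp(-2). The weight in front of the power of [C1] is at most 1. *)
Lemma Kconst_le (R : realType) (a l : R) (d : nat) : 0 < a -> 0 < l < 1 ->
  Kconst a d l <= 2 * (4 / expR 2) ^+ d.
Proof.
move=> a0 /andP[l0 l1].
have la0 : 0 < l * a by rewrite mulr_gt0.
have l1' : 0 < 1 - l by rewrite subr_gt0.
have a1 : 0 < a + 1 by rewrite addr_gt0.
pose u := (a + 1) ^+ 2 / a.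
have u4 : 4 <= u.
  by rewrite ler_pdivlMr//; have := sqr_ge0 (a - 1); lra.
have ue : u * expR (- (u / 2)) <= 4 / expR 2.
  have e4 := expR_ge1Dx (u / 2 - 2).
  rewrite ler_pdivlMr ?expR_gt0// -mulrA -expRD -ler_pdivlMr ?expR_gt0//.
  rewrite -expRN (_ : - (- (u / 2) + 2) = u / 2 - 2); last by lra.
  by lra.
have bnd m e : m <= u -> e <= - (u / 2) -> Num.max 4 m * expR e <= 4 / expR 2.
  move=> mu eu; apply: le_trans ue.
  by rewrite ler_pM ?expR_ge0 ?ler_expR// ?ge_max ?u4 ?mu// le_max ler0n.
have bexp x y : a^-1 <= x -> (a + 1) ^+ 2 <= y -> - (1 / 2) * x * y <= - (u / 2).
  move=> ax ay.
  have i0 : 0 <= a^-1 by rewrite invr_ge0 ltW.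
  have := ler_pM i0 (sqr_ge0 _) ax ay.
  by rewrite /u; lra.
have c1 : C1 a l <= 4 / expR 2.
  apply: bnd; first by rewrite ler_pM2l ?exprn_gt0// lef_pV2 ?posrE ?mulr_gt0//;
    [rewrite ler_peMr//|]; lra.
  apply: bexp; last by rewrite lerDl divr_ge0 ?addr_ge0 ?(ltW la0).
  rewrite ler_pdivlMr ?mulr_gt0// mulrCA mulVf ?lt0r_neq0// mulr1; lra.
have c2 : C2 a l <= 4 / expR 2.
  apply: bnd.
    by rewrite ler_pM2l ?exprn_gt0// lef_pV2 ?posrE ?addr_gt0// lerDl ltW.
  apply: bexp; last by rewrite lerDl divr_ge0 ?mulr_ge0 ?sqr_ge0 ?addr_ge0 ?(ltW a0) ?(ltW l0).
  rewrite ler_pdivlMr ?mulr_gt0 ?exprn_gt0// expr2 mulrCA mulKf ?lt0r_neq0//; nra.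
have m0 m : 0 <= Num.max 4 m :> R by rewrite le_max ler0n.
have C10 : 0 <= C1 a l by rewrite mulr_ge0 ?expR_ge0.
have C20 : 0 <= C2 a l by rewrite mulr_ge0 ?expR_ge0.
have d1 : C1 a l ^+ d <= (4 / expR 2) ^+ d.
  by rewrite lerXn2r ?nnegrE ?divr_ge0 ?expR_ge0.
have d2 : C2 a l ^+ d <= (4 / expR 2) ^+ d.
  by rewrite lerXn2r ?nnegrE ?divr_ge0 ?expR_ge0.
have w1 : ((1 - l) * a + 1) / (a + 1) * C1 a l ^+ d <= C1 a l ^+ d.
  by rewrite ler_piMl ?exprn_ge0// ler_pdivrMr// mul1r; nra.
by rewrite /Kconst; lra.
Qed.

(** The square root in [Lroot] is at least a + 1; which entry of the maximum serves depends on
    whether a >= 1. *)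
Lemma Lbound_ge4 (R : realType) (a l : R) (n : nat) : 0 < a -> 0 < l < 1 ->
  (Lbound a l <= n)%N -> (4 <= n)%N.
Proof.
move=> a0 /andP[l0 l1] Ln.
have la0 : 0 < l * a by rewrite mulr_gt0.
have root_ge : 2 * (a + 1) <= Lroot a l.
  have : a + 1 <= Num.sqrt ((a + 1) ^+ 2 + 4 * l * a).
    rewrite -{1}(@ger0_norm _ (a + 1)) ?addr_ge0 ?(ltW a0)// -sqrtr_sqr.
    by rewrite ler_wsqrtr// lerDl -mulrA mulr_ge0// ltW.
  by rewrite /Lroot; lra.
have sq4 (x : R) : 2 <= x -> (Num.truncn (x ^+ 2) < n)%N -> (4 <= n)%N.
  move=> x2 xn; rewrite -(ler_nat R) ltW//.
  apply: le_lt_trans (lt_le_trans (truncnS_gt (x ^+ 2)) _); first by nra.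
  by rewrite ler_nat.
have [a1|a1] := leP 1 a.
  apply: (sq4 (Lroot a l / (2 * l))).
    by rewrite ler_pdivlMr ?mulr_gt0//; apply: le_trans root_ge; nra.
  by rewrite (leq_trans _ Ln)// leq_maxr.
apply: (sq4 (Lroot a l / (2 * l * a))).
  by rewrite ler_pdivlMr ?mulr_gt0//; apply: le_trans root_ge; nra.
by rewrite (leq_trans _ Ln)// leq_maxl.
Qed.

Lemma sum_odds_pmf_expr_Lbound (R : realType) (a l : R) (n d : nat) :
  0 < a -> 0 < l < 1 -> (Lbound a l <= n)%N ->
  (Num.sqrt (2 * pi) / expR 2) ^+ d.+1 * Kconst a d.+1 l / Num.sqrt n%:R ^+ d <=
  \sum_(k < n.+1) odds_pmf a n k ^+ d.+1.
Proof.
move=> a0 l01 Ln; have n4 := Lbound_ge4 a0 l01 Ln.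
apply: le_trans (sum_odds_pmf_expr_ge d a0 n4).
rewrite [X in _ <= _ * X]expr_div_n [leRHS]mulrA ler_pM2r ?invr_gt0 ?exprn_gt0 ?sqrtr_gt0 ?ltr0n ?(leq_trans _ n4)//.
set s := Num.sqrt (2 * pi) / expR 2.
have s0 : 0 <= s by rewrite divr_ge0 ?sqrtr_ge0 ?expR_ge0.
(* 4 sqrt(2 pi)/e^4 <= 4 (29/10)/40 < 3/10, the constant of [sum_odds_pmf_expr_ge]; then 2 (3/10)^(d
   + 1) <= (3/4) (3/10)^d concludes. *)
have s3 : s * (4 / expR 2) <= 3 / 10.
  have sp : Num.sqrt (2 * pi) <= 29 / 10 :> R.
    rewrite -ler_sqr ?nnegrE ?sqrtr_ge0 ?divr_ge0// sqr_sqrtr ?mulr_ge0 ?pi_ge0//.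
    by have := pihalf_lt2 R; lra.
  rewrite /s mulf_div -expRD (_ : 2 + 2 = 4); last by lra.
  by rewrite ler_pdivrMr ?expR_gt0//; have := expR4_ge R; lra.
clearbody s.
apply: (@le_trans _ _ (2 * (s * (4 / expR 2)) ^+ d.+1)).
  by rewrite exprMn mulrCA ler_wpM2l ?exprn_ge0 ?Kconst_le.
apply: (@le_trans _ _ (2 * (3 / 10) ^+ d.+1)).
  by rewrite ler_pM2l// lerXn2r ?nnegrE ?mulr_ge0 ?divr_ge0 ?expR_ge0.
have : 0 <= (3 / 10) ^+ d :> R by rewrite exprn_ge0// divr_ge0.
by rewrite exprS; lra.
Qed.

(** * Bounds on the coefficients [rr] *)

Lemma npow_half (R : realType) (n m : nat) :
  npow n (m%:R / 2) = (Num.sqrt n%:R ^+ m)^-1 :> R.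
Proof.
rewrite /npow powRN; congr (_^-1).
rewrite -powR12_sqrt// -powR_mulrn ?powR_ge0// -powRrM mulrC.
by congr (_ `^ _); rewrite mulrC; lra.
Qed.

Section rr_bounds.
Context (R : realType) (d : nat) (p : 'I_d -> R).
Context (d0 : (0 < d)%N) (p01 : forall j, 0 < p j < 1).

Let p_gt0 j : 0 < p j. Proof. by have /andP[] := p01 j. Qed.
Let q_gt0 j : 0 < qq p j.
Proof. by have /andP[_] := p01 j; rewrite /qq subr_gt0. Qed.

Lemma QQ_gt0 : 0 < QQ p. Proof. by apply: prodr_gt0 => j _; exact: q_gt0. Qed.

Lemma PP_gt0 : 0 < PP p.
Proof. by apply: prodr_gt0 => j _; rewrite divr_gt0. Qed.

Lemma alpha_gt0 : 0 < alpha p. Proof. exact: powR_gt0 PP_gt0. Qed.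

Let d_neq0 : d%:R != 0 :> R. Proof. by rewrite pnatr_eq0 -lt0n. Qed.

Lemma powR_invnK (x : R) : 0 <= x -> (x `^ d%:R^-1) ^+ d = x.
Proof.
by move=> x0; rewrite -powR_mulrn ?powR_ge0// -powRrM mulVf// powRr1.
Qed.

Lemma TT_gt0 : 0 < TT p.
Proof. by rewrite mulr_gt0 ?QQ_gt0 ?exprn_gt0 ?addr_gt0 ?alpha_gt0. Qed.

(** T is the d-th power of the sum of the geometric means of the q_j and of the p_j; the two
    arithmetic means add up to 1. *)
Lemma TT_le1 : TT p <= 1.
Proof.
have amgm (x : 'I_d -> R) : (forall j, 0 < x j) ->
    (\prod_j x j) `^ d%:R^-1 <= (\sum_j x j) / d%:R.
  move=> x0; have x0' : 0 <= \prod_j x j by rewrite prodr_ge0// => j _; rewrite ltW.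
  have := @leif_AGM _ _ 'I_d x (fun j _ => ltW (x0 j)).
  rewrite /= card_ord => -[+ _].
  by rewrite -[leLHS](powR_invnK x0') ler_pXn2r ?nnegrE ?powR_ge0 ?divr_ge0// sumr_ge0// => j _; rewrite ltW.
have QP : QQ p * PP p = \prod_j p j.
  rewrite -big_split; apply: eq_bigr => j _ /=.
  by rewrite mulrC divfK ?lt0r_neq0.
rewrite /TT -(powR_invnK (ltW QQ_gt0)) -exprMn exprn_ile1//.
  by rewrite mulr_ge0 ?powR_ge0// addr_ge0 ?(ltW alpha_gt0).
rewrite mulrDr mulr1 /alpha -powRM ?(ltW QQ_gt0) ?(ltW PP_gt0)// QP.
apply: le_trans (lerD (amgm _ q_gt0) (amgm _ p_gt0)) _.
rewrite -mulrDl -big_split /=.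
under eq_bigr => j _ do rewrite /qq subrK.
by rewrite sumr_const card_ord divff.
Qed.

Lemma rrE n : rr p n = TT p ^+ n * \sum_(k < n.+1) odds_pmf (alpha p) n k ^+ d.
Proof.
have a1 : 1 + alpha p != 0 by rewrite lt0r_neq0 ?addr_gt0 ?alpha_gt0.
rewrite /rr /TT exprMn -mulrA; congr (_ * _).
rewrite mulr_sumr; apply: eq_bigr => k _.
rewrite /odds_pmf !exprMn exprVn [X in _ = X * _]exprAC.
rewrite -[PP p]powR_invnK ?ltW ?PP_gt0// -/(alpha p) exprAC.
by rewrite [RHS]mulrC divfK// !expf_neq0.
Qed.

Lemma rr_le l n : 0 < l < 1 -> (Nbound (alpha p) l <= n)%N ->
  rr p n <= (Mbound (alpha p) l / Num.sqrt (2 * pi)) ^+ d.-1 *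
            (npow n ((d%:R - 1) / 2) * TT p ^+ n).
Proof.
move=> l01 Nn; have a0 := alpha_gt0.
have -> : d%:R - 1 = d.-1%:R :> R by rewrite -{1}(prednK d0) -natr1 addrK.
rewrite npow_half rrE mulrA [leLHS]mulrC ler_wpM2r ?exprn_ge0 ?(ltW TT_gt0)//.
(* One factor of each d-th power is kept and sums to 1; [odds_pmf_le] bounds the other d - 1. *)
rewrite -exprVn -exprMn -[leRHS]mulr1
  -[X in _ <= _ * X](sum_odds_pmf n (ltW a0)) mulr_sumr.
apply: ler_sum => k _; rewrite -[X in _ ^+ X <= _](prednK d0) exprSr.
rewrite ler_wpM2r ?odds_pmf_ge0 ?(ltW a0)//.
have o := odds_pmf_le a0 l01 Nn (ltn_ord k : (k <= n)%N).
by rewrite lerXn2r ?nnegrE ?odds_pmf_ge0 ?(ltW a0)// (le_trans _ o) ?odds_pmf_ge0 ?(ltW a0).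
Qed.

Lemma rr_ge l n : 0 < l < 1 -> (Lbound (alpha p) l <= n)%N ->
  (Num.sqrt (2 * pi) / expR 2) ^+ d * Kconst (alpha p) d l *
    (npow n ((d%:R - 1) / 2) * TT p ^+ n) <= rr p n.
Proof.
move=> l01 Ln; have a0 := alpha_gt0.
have -> : d%:R - 1 = d.-1%:R :> R by rewrite -{1}(prednK d0) -natr1 addrK.
rewrite npow_half rrE mulrA [leRHS]mulrC ler_wpM2r ?exprn_ge0 ?(ltW TT_gt0)//.
by have := sum_odds_pmf_expr_Lbound d.-1 a0 l01 Ln; rewrite prednK.
Qed.

Lemma rr_ge0 n : 0 <= rr p n.
Proof.
rewrite rrE mulr_ge0 ?exprn_ge0 ?(ltW TT_gt0)// sumr_ge0// => k _.
by rewrite exprn_ge0// odds_pmf_ge0 ?(ltW alpha_gt0).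
Qed.

Lemma rr_le1 n : rr p n <= 1.
Proof.
have a0 := ltW alpha_gt0.
rewrite rrE mulr_ile1 ?exprn_ge0 ?exprn_ile1 ?TT_le1 ?(ltW TT_gt0)//.
  by rewrite sumr_ge0// => k _; rewrite exprn_ge0// odds_pmf_ge0.
rewrite -(sum_odds_pmf n a0) ler_sum// => k _.
rewrite -[leRHS]expr1 ler_wiXn2l ?odds_pmf_ge0//.
rewrite -(sum_odds_pmf n a0) (bigD1 k)//= lerDl sumr_ge0// => i _.
exact: odds_pmf_ge0.
Qed.

End rr_bounds.

(** * The law of the trials and the renewal equation *)

Lemma sum_bernoulli_weight (R : realType) (x : R) (n k : nat) :
  \sum_(u : {ffun 'I_n -> bool})
    (if (\sum_i u i == k)%N then \prod_i (if u i then x else 1 - x) else 0) =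
  'C(n, k)%:R * x ^+ k * (1 - x) ^+ (n - k).
Proof.
(* Outcomes correspond to their sets of successes; all sets of k elements carry the same weight. *)
rewrite (reindex (fun A : {set 'I_n} => [ffun i => i \in A])); last first.
  exists (fun u : {ffun 'I_n -> bool} => [set i | u i]%SET) => u _.
    by apply/setP => i; rewrite inE ffunE.
  by apply/ffunP => i; rewrite ffunE inE.
rewrite -big_mkcond /=.
have sE (A : {set 'I_n}) : (\sum_i [ffun i => i \in A] i = #|A|)%N.
  rewrite -sum1_card [RHS]big_mkcond; apply: eq_bigr => i _.
  by rewrite ffunE; case: (i \in A).
rewrite (eq_bigl (fun A : {set 'I_n} => A \in [set B : {set 'I_n} | #|B| == k]%SET)); last first.
  by move=> A; rewrite inE sE.
rewrite (eq_bigr (fun=> x ^+ k * (1 - x) ^+ (n - k))); last first.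
  move=> A; rewrite inE => /eqP Ak.
  rewrite (bigID (mem A))/=; congr (_ * _).
    rewrite (eq_bigr (fun=> x)) ?prodr_const ?Ak// => i iA.
    by rewrite ffunE iA.
  rewrite (eq_bigr (fun=> 1 - x)) => [|i /negbTE iA]; last by rewrite ffunE iA.
  rewrite prodr_const; congr (_ ^+ _).
  by have := cardC A; rewrite card_ord Ak => /(congr1 (subn^~ k)); rewrite addKn.
by rewrite sumr_const card_draws card_ord -[LHS]mulr_natl mulrA.
Qed.

Section renewal.
Context (R : realType) (d : nat) (p : 'I_d -> R).

Definition prob_all_equal (n : nat) : R :=
  \sum_(w : {ffun 'I_d * 'I_n -> bool} | all_equal_at w n) outcome_weight p w.

Lemma outcome_weightE n (w : {ffun 'I_d * 'I_n -> bool}) :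
  outcome_weight p w = \prod_j \prod_i (if w (j, i) then p j else 1 - p j).
Proof. by rewrite pair_bigA; apply: eq_bigr => -[j i]. Qed.

Lemma prob_all_equalE (n : nat) : (0 < d)%N -> (forall j, p j < 1) ->
  prob_all_equal n = rr p n.
Proof.
move=> d0 p1; rewrite /prob_all_equal.
have q0 j : qq p j != 0 by rewrite subr_eq0 gt_eqF.
pose j0 := Ordinal d0.
rewrite (reindex (fun v : {ffun 'I_d -> {ffun 'I_n -> bool}} =>
    [ffun ji : 'I_d * 'I_n => v ji.1 ji.2])); last first.
  exists (fun w : {ffun 'I_d * 'I_n -> bool} => [ffun j => [ffun i => w (j, i)]]) => w _.
    by apply/ffunP => j; apply/ffunP => i; rewrite !ffunE.
  by apply/ffunP => -[j i]; rewrite !ffunE.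
pose S (u : {ffun 'I_n -> bool}) := (\sum_i u i)%N.
pose g k j (u : {ffun 'I_n -> bool}) : R :=
  if S u == k then \prod_i (if u i then p j else 1 - p j) else 0.
have SE (v : {ffun 'I_d -> {ffun 'I_n -> bool}}) j :
    partial_sum [ffun ji : 'I_d * 'I_n => v ji.1 ji.2] j n = S (v j).
  by apply: eq_big => [i|i _]; rewrite ?ltn_ord// ffunE.
(* Split by the common value k of the sums: if they agree, exactly one k contributes, otherwise each
   product has a zero factor. *)
transitivity (\sum_(v : {ffun 'I_d -> {ffun 'I_n -> bool}})
    \sum_(k < n.+1) \prod_j g k j (v j)).
  rewrite big_mkcond; apply: eq_bigr => v _.
  case: ifP => [|/negbT] Ev.
    have Sv j : S (v j) = S (v j0).
      by move/forallP: Ev => /(_ j)/forallP/(_ j0)/eqP; rewrite !SE.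
    have Sn : (S (v j0) < n.+1)%N.
      rewrite ltnS -[X in (_ <= X)%N]card_ord -sum1_card leq_sum// => i _.
      exact: leq_b1.
    rewrite (bigD1 (Ordinal Sn))//= [X in _ + X]big1 ?addr0 => [|k kS].
      rewrite outcome_weightE.
      apply: eq_bigr => j _; rewrite /g /= Sv eqxx; apply: eq_bigr => i _.
      by rewrite ffunE.
    rewrite (bigD1 j0)//= /g ifN ?mul0r//.
    by apply: contraNneq kS => kS; apply/eqP/val_inj.
  rewrite big1// => k _.
  move: Ev; rewrite negb_forall => /existsP[j]; rewrite negb_forall => /existsP[j'].
  rewrite !SE => jj'.
  have [Sk|Sk] := eqVneq (S (v j)) k.
    by rewrite (bigD1 j')//= /g -Sk eq_sym (negbTE jj') mul0r.
  by rewrite (bigD1 j)//= /g (negbTE Sk) mul0r.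
rewrite exchange_big /rr mulr_sumr; apply: eq_bigr => k _.
(* Independence of the d sequences: the sum over families of rows is a product of sums over single
   rows. *)
rewrite -(bigA_distr_bigA (g k)).
rewrite (eq_bigr (fun j => qq p j ^+ n * ('C(n, k)%:R * (p j / qq p j) ^+ k))).
  by rewrite !big_split /= prodr_const card_ord !prodrXl.
move=> j _; rewrite /g sum_bernoulli_weight -/(qq p j) expr_div_n.
rewrite -[X in _ = _ ^+ X * _](subnKC (ltn_ord k : (k <= n)%N)) exprD; field.
by rewrite expf_neq0.
Qed.

(** Concatenation of k trials with m later ones; independence of the two blocks is
    [outcome_weight_glue]. *)
Definition glue k m (w : {ffun 'I_d * 'I_k -> bool} * {ffun 'I_d * 'I_m -> bool}) :
    {ffun 'I_d * 'I_(k + m) -> bool} :=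
  [ffun ji => match fintype.split ji.2 with
              | inl i => w.1 (ji.1, i)
              | inr i => w.2 (ji.1, i)
              end].

Lemma glueL k m w j i : @glue k m w (j, lshift m i) = w.1 (j, i).
Proof. by rewrite ffunE /= (unsplitK (inl i)). Qed.

Lemma glueR k m w j i : @glue k m w (j, rshift k i) = w.2 (j, i).
Proof. by rewrite ffunE /= (unsplitK (inr i)). Qed.

Lemma glue_bij k m : bijective (@glue k m).
Proof.
exists (fun w : {ffun 'I_d * 'I_(k + m) -> bool} =>
    ([ffun ji : 'I_d * 'I_k => w (ji.1, lshift m ji.2)],
     [ffun ji : 'I_d * 'I_m => w (ji.1, rshift k ji.2)])).
  by case=> w1 w2; congr (_, _); apply/ffunP => -[j i]; rewrite ffunE /= ?glueL ?glueR.
move=> w; apply/ffunP => -[j i]; rewrite -(fintype.splitK i).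
by case: (fintype.split i) => i' /=; rewrite ?glueL ?glueR ffunE.
Qed.

Lemma outcome_weight_glue k m w :
  outcome_weight p (@glue k m w) = outcome_weight p w.1 * outcome_weight p w.2.
Proof.
rewrite !outcome_weightE -big_split; apply: eq_bigr => j _ /=.
rewrite big_split_ord /=; congr (_ * _); apply: eq_bigr => i _.
  by rewrite glueL.
by rewrite glueR.
Qed.

Lemma partial_sum_glueL k m w j i : (i <= k)%N ->
  partial_sum (@glue k m w) j i = partial_sum w.1 j i.
Proof.
move=> ik; rewrite /partial_sum big_split_ord /= [X in (_ + X)%N]big1 ?addn0.
  by apply: eq_bigr => i' _; rewrite glueL.
move=> i'; rewrite ltnNge (leq_trans ik) ?leq_addr//.
Qed.

Lemma partial_sum_glueR k m w j i :
  partial_sum (@glue k m w) j (k + i) = (partial_sum w.1 j k + partial_sum w.2 j i)%N.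
Proof.
rewrite /partial_sum big_split_ord /=; congr (_ + _)%N; apply: eq_big => i'.
- by rewrite ltn_ord (leq_trans (ltn_ord i')) ?leq_addr.
- by rewrite glueL.
- by rewrite ltn_add2l.
- by rewrite glueR.
Qed.

Lemma all_equal_at_glueL k m w i : (i <= k)%N ->
  all_equal_at (@glue k m w) i = all_equal_at w.1 i.
Proof.
by move=> ik; apply: eq_forallb => j; apply: eq_forallb => j';
  rewrite !partial_sum_glueL.
Qed.

(** After a rencontre all partial sums restart from one common value. *)
Lemma all_equal_at_glueR k m w : all_equal_at w.1 k ->
  all_equal_at (@glue k m w) (k + m) = all_equal_at w.2 m.
Proof.
move=> /forallP w1k; apply: eq_forallb => j; apply: eq_forallb => j'.
by have /forallP/(_ j')/eqP := w1k j; rewrite !partial_sum_glueR => ->; rewrite eqn_add2l.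
Qed.

(** The event J = k read off from n trials, whereas [first_rencontre_at] ties the time to the number
    of trials. *)
Definition first_equal_at n (w : {ffun 'I_d * 'I_n -> bool}) (k : nat) :=
  [&& (0 < k)%N, all_equal_at w k &
      [forall m : 'I_k, (0 < (m : nat))%N ==> ~~ all_equal_at w m]].

Lemma prob_first_then_equal k m :
  \sum_(w : {ffun 'I_d * 'I_(k + m) -> bool} |
      first_equal_at w k && all_equal_at w (k + m)) outcome_weight p w =
  prob_J p k * prob_all_equal m.
Proof.
rewrite (reindex (@glue k m)) /=; last exact: onW_bij (glue_bij k m).
rewrite big_distrlr /= pair_big /=; apply: eq_big => [w|w _]; last first.
  exact: outcome_weight_glue.
have -> : first_equal_at (glue w) k = first_rencontre_at w.1.
  congr [&& _, _ & _]; first exact: all_equal_at_glueL.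
  by apply: eq_forallb => i; rewrite all_equal_at_glueL// ltnW.
have [/and3P[_ wk _]|//] := boolP (first_rencontre_at w.1).
exact: all_equal_at_glueR.
Qed.

Lemma renewal n : (0 < n)%N ->
  prob_all_equal n = \sum_(k < n) prob_J p k.+1 * prob_all_equal (n - k.+1).
Proof.
move=> n0.
have firstE (k : 'I_n) : prob_J p k.+1 * prob_all_equal (n - k.+1) =
    \sum_(w : {ffun 'I_d * 'I_n -> bool} |
      first_equal_at w k.+1 && all_equal_at w n) outcome_weight p w.
  have := prob_first_then_equal k.+1 (n - k.+1).
  by rewrite subnKC.
under eq_bigr => k _ do rewrite firstE big_mkcond.
rewrite exchange_big /prob_all_equal big_mkcond; apply: eq_bigr => w _ /=.
case: ifP => [wn|_]; last by rewrite big1// => k _; rewrite andbF.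
(* The least positive time of equality is the only index whose event contains w. *)
have ex : exists k, (0 < k)%N && all_equal_at w k by exists n; rewrite n0.
case: (ex_minnP ex) => [[|k]//] /= wk kmin.
have kn : (k < n)%N by apply: kmin; rewrite n0.
rewrite (bigD1 (Ordinal kn))//= big1 ?addr0 => [|i ik].
  rewrite ifT// /first_equal_at wk /= andbT; apply/forallP => i; apply/implyP => i0.
  by apply/negP => wi; have := kmin i; rewrite i0 wi leqNgt ltn_ord => /(_ isT).
rewrite ifN//; apply/negP => /andP[/and3P[_ wi /forallP fi] _].
have ki : (k < i)%N.
  rewrite ltn_neqAle -ltnS kmin ?andbT; last by rewrite wi.
  by apply: contraNneq ik => ki; apply/eqP/val_inj.
by have := fi (Ordinal (ki : (k.+1 < i.+1)%N)); rewrite /= wk.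
Qed.

Lemma outcome_weight_ge0 n (w : {ffun 'I_d * 'I_n -> bool}) :
  (forall j, 0 < p j < 1) -> 0 <= outcome_weight p w.
Proof.
move=> p01; apply: prodr_ge0 => ji _.
by have /andP[p0 p1] := p01 ji.1; case: ifP => _; rewrite ?subr_ge0 ltW.
Qed.

Lemma prob_J_ge0 n : (forall j, 0 < p j < 1) -> 0 <= prob_J p n.
Proof.
by move=> p01; apply: sumr_ge0 => w _; exact: outcome_weight_ge0.
Qed.

Lemma prob_J0 : prob_J p 0 = 0.
Proof. by rewrite /prob_J big1. Qed.

End renewal.

(** * Nonnegative series and Abel's theorem *)

Lemma nneseries_EFin_le (R : realType) (u : nat -> R) (M : R) :
  (forall n, 0 <= u n) -> (forall N, \sum_(0 <= n < N) u n <= M) ->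
  (\sum_(n <oo) (u n)%:E <= M%:E)%E.
Proof.
move=> u0 uM; apply: lime_le.
  by apply: is_cvg_nneseries => n _ _; rewrite lee_fin.
by apply: nearW => N; rewrite sumEFin lee_fin.
Qed.

Lemma sum_EFin_le_nneseries (R : realType) (u : nat -> R) (N : nat) :
  (forall n, 0 <= u n) ->
  ((\sum_(0 <= n < N) u n)%:E <= \sum_(n <oo) (u n)%:E)%E.
Proof.
by move=> u0; rewrite -sumEFin; apply: nneseries_lim_ge => n _ _; rewrite lee_fin.
Qed.

Lemma nneseries_EFin_ge0 (R : realType) (u : nat -> R) :
  (forall n, 0 <= u n) -> (0 <= \sum_(n <oo) (u n)%:E)%E.
Proof. by move=> u0; apply: nneseries_ge0 => n _ _; rewrite lee_fin. Qed.

Lemma nneseries_EFin_fin_num (R : realType) (u : nat -> R) (M : R) :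
  (forall n, 0 <= u n) -> (forall N, \sum_(0 <= n < N) u n <= M) ->
  (\sum_(n <oo) (u n)%:E)%E \is a fin_num.
Proof.
move=> u0 uM; rewrite ge0_fin_numE ?nneseries_EFin_ge0//.
exact: le_lt_trans (nneseries_EFin_le u0 uM) (ltry _).
Qed.

Lemma lt_nneseries (R : realType) (u : nat -> R) (t : R) :
  (forall n, 0 <= u n) -> (t%:E < \sum_(n <oo) (u n)%:E)%E ->
  exists N, t < \sum_(0 <= n < N) u n.
Proof.
move=> u0 tu; apply: contrapT => /forallNP h.
suff : (\sum_(n <oo) (u n)%:E <= t%:E)%E by rewrite leNgt tu.
by apply: nneseries_EFin_le => // N; rewrite leNgt; apply/negP.
Qed.

(** The limit may be infinite. From below, a partial sum is a polynomial, continuous at 1; from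
    above, each term is at most its value at 1. The free exponents serve both a power series and its
    derivative. *)
Lemma abel_at_left (R : realType) (u : nat -> R) (e : nat -> nat) :
  (forall n, 0 <= u n) ->
  (\sum_(n <oo) (u n * x ^+ e n)%:E)%E @[x --> (1 : R)^'-] -->
  (\sum_(n <oo) (u n)%:E)%E.
Proof.
move=> u0.
have low t : (t%:E < \sum_(n <oo) (u n)%:E)%E ->
    \forall x \near (1 : R)^'-, (t%:E < \sum_(n <oo) (u n * x ^+ e n)%:E)%E.
  move=> /(lt_nneseries u0)[N tN].
  pose q : {poly R} := \sum_(0 <= n < N) u n *: 'X^(e n).
  have qE x : q.[x] = \sum_(0 <= n < N) u n * x ^+ e n.
    by rewrite horner_sum; apply: eq_bigr => n _; rewrite hornerZ hornerXn.
  have q1 : t < q.[1].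
    by rewrite qE; under eq_bigr => n _ do rewrite expr1n mulr1.
  have qc : q.[x] @[x --> (1 : R)^'-] --> q.[1].
    by apply: cvg_at_left_filter; exact: continuous_horner.
  near=> x.
  have x0 : 0 <= x by near: x; exact: nbhs_left_ge.
  have tx : t < q.[x] by near: x; exact: cvgr_gt qc _ q1.
  apply: lt_le_trans (sum_EFin_le_nneseries N _).
    by rewrite -qE lte_fin.
  by move=> n; rewrite mulr_ge0 ?exprn_ge0.
have up : \forall x \near (1 : R)^'-,
    (\sum_(n <oo) (u n * x ^+ e n)%:E <= \sum_(n <oo) (u n)%:E)%E.
  near=> x.
  have x0 : 0 <= x by near: x; exact: nbhs_left_ge.
  have x1 : x <= 1 by near: x; exact: nbhs_left_le.
  apply: lee_nneseries => n *; rewrite lee_fin ?mulr_ge0 ?exprn_ge0//.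
  by rewrite ler_piMr// exprn_ile1.
have [ufin|] := boolP ((\sum_(n <oo) (u n)%:E)%E \is a fin_num); last first.
  rewrite ge0_fin_numE ?nneseries_EFin_ge0// -leNgt leye_eq => /eqP uy.
  rewrite uy; apply/cvgeyPgt => t; apply: low; rewrite uy; exact: ltry.
rewrite -(fineK ufin); apply/fine_cvgP; split.
  near=> x; rewrite ge0_fin_numE; first last.
    apply: nneseries_EFin_ge0 => n; rewrite mulr_ge0 ?exprn_ge0//.
    by near: x; exact: nbhs_left_ge.
  apply: (@le_lt_trans _ _ (\sum_(n <oo) (u n)%:E)%E); last by rewrite ltey_eq ufin.
  by near: x.
apply/cvgrPdist_lt => eps eps0; near=> x.
have fx : (\sum_(n <oo) (u n)%:E - eps%:E < \sum_(n <oo) (u n * x ^+ e n)%:E <=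
           \sum_(n <oo) (u n)%:E)%E.
  apply/andP; split; last by near: x.
  rewrite -(fineK ufin) -EFinB; near: x; apply: low.
  by rewrite -(fineK ufin) lte_fin ltrBlDr ltrDl.
rewrite /=; move: fx; rewrite -(fineK ufin); set l := fine _.
case: (\sum_(n <oo) (u n * x ^+ e n)%:E)%E => [r| |] /andP[]//.
rewrite -EFinB lte_fin lee_fin /= => h1 h2.
by rewrite ger0_norm ?subr_ge0// ltrBlDr -ltrBlDl.
Unshelve. all: by end_near. Qed.

(** Tonelli's theorem for the triangular array [a], extended by zero to k > n. *)
Lemma nneseries_cauchy (R : realType) (f g : nat -> R) :
  (forall n, 0 <= f n) -> (forall n, 0 <= g n) ->
  (\sum_(n <oo) (g n)%:E)%E \is a fin_num ->
  (\sum_(n <oo) (\sum_(k < n.+1) f k * g (n - k)%N)%:E =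
   (\sum_(n <oo) (f n)%:E) * (\sum_(n <oo) (g n)%:E))%E.
Proof.
move=> f0 g0 gfin.
pose a n k := if (k <= n)%N then (f k * g (n - k)%N)%:E else 0%E.
have a0 n k : (0 <= a n k)%E by rewrite /a; case: ifP => // _; rewrite lee_fin mulr_ge0.
transitivity (\sum_(n <oo) \sum_(k <oo) a n k)%E.
  apply: eq_eseriesr => n _.
  rewrite (nneseries_split 0 n.+1)// add0n [X in (_ + X)%E]eseries0 ?adde0.
    rewrite big_mkord -sumEFin; apply: eq_bigr => k _.
    by rewrite /a -ltnS ltn_ord.
  by move=> k nk _; rewrite /a leqNgt nk.
rewrite nneseries_interchange// muleC -(fineK gfin) -nneseriesZl; last first.
  by move=> k _; rewrite lee_fin.
apply: eq_eseriesr => k _; rewrite fineK// muleC.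
rewrite (nneseries_split 0 k)// add0n big_nat big1 ?add0e; last first.
  by move=> n /andP[_ nk]; rewrite /a leqNgt nk.
rewrite -nneseries_addn// -nneseriesZl; last by move=> n _; rewrite lee_fin.
by apply: eq_eseriesr => n _; rewrite /a leq_addl addnK EFinM.
Qed.

(** * Generating functions on (0, 1) *)

Definition pgf (R : realType) (a : nat -> R) (x : R) : R :=
  fine (\sum_(n <oo) (a n * x ^+ n)%:E)%E.

(** The term at n = 0 vanishes, so [n.-1] does no harm there. For bounded coefficients and 0 < x <
    1, [fine] meets finite sums only, by [pgf_fin_num] and [dpgf_fin_num]. *)
Definition dpgf (R : realType) (a : nat -> R) (x : R) : R :=
  fine (\sum_(n <oo) (n%:R * a n * x ^+ n.-1)%:E)%E.

Lemma sum_geometric_le (R : realType) (x : R) (N : nat) : 0 < x < 1 ->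
  \sum_(0 <= n < N) x ^+ n <= (1 - x)^-1.
Proof.
move=> /andP[x0 x1]; have s0 : 0 < 1 - x by rewrite subr_gt0.
rewrite -[leRHS]mul1r ler_pdivlMr//.
suff -> : (\sum_(0 <= n < N) x ^+ n) * (1 - x) = 1 - x ^+ N.
  by rewrite gerBl exprn_ge0// ltW.
elim: N => [|N IH]; first by rewrite big_geq// mul0r expr0 subrr.
by rewrite big_nat_recr//= mulrDl IH exprS; ring.
Qed.

Lemma sum_dgeometric_le (R : realType) (x : R) (N : nat) : 0 < x < 1 ->
  \sum_(0 <= n < N) n%:R * x ^+ n.-1 <= ((1 - x) ^+ 2)^-1.
Proof.
move=> /andP[x0 x1]; have s0 : 0 < 1 - x by rewrite subr_gt0.
rewrite -[leRHS]mul1r ler_pdivlMr ?exprn_gt0//.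
case: N => [|N]; first by rewrite big_geq// mul0r.
suff -> : (\sum_(0 <= n < N.+1) n%:R * x ^+ n.-1) * (1 - x) ^+ 2 =
    1 - x ^+ N * (1 + N%:R * (1 - x)).
  by rewrite gerBl mulr_ge0 ?exprn_ge0 ?addr_ge0 ?mulr_ge0// ltW.
elim: N => [|N IH]; first by rewrite big_nat1 !mul0r addr0 expr0 mul1r subrr.
by rewrite big_nat_recr//= mulrDl IH [x ^+ N.+1]exprS -natr1; ring.
Qed.

(** Telescoping: for n >= 2, 1/(n sqrt n) <= 2/sqrt(n - 1) - 2/sqrt n, and the first term is 1. *)
Lemma sum_sqrt3_le (R : realType) (N : nat) :
  \sum_(0 <= n < N) (n.+1%:R * Num.sqrt n.+1%:R)^-1 <= 3 :> R.
Proof.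
case: N => [|N]; first by rewrite big_geq.
suff h : \sum_(0 <= n < N.+1) (n.+1%:R * Num.sqrt n.+1%:R)^-1 <=
    3 - 2 / Num.sqrt N.+1%:R :> R.
  by rewrite (le_trans h)// gerBl divr_ge0// sqrtr_ge0.
elim: N => [|N IH]; first by rewrite big_nat1 sqrtr1 mulr1 invr1 mulr1; lra.
rewrite big_nat_recr//=; apply: le_trans (lerD IH (lexx _)) _.
set y := Num.sqrt N.+1%:R; set z := Num.sqrt N.+2%:R.
have y0 : 0 < y by rewrite sqrtr_gt0 ltr0n.
have z0 : 0 < z by rewrite sqrtr_gt0 ltr0n.
have y2 : y ^+ 2 = N.+1%:R by rewrite sqr_sqrtr.
have z2 : z ^+ 2 = y ^+ 2 + 1 by rewrite y2 sqr_sqrtr ?ler0n// natr1.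
rewrite (_ : N.+2%:R = z ^+ 2); last by rewrite sqr_sqrtr.
rewrite -subr_ge0.
rewrite (_ : _ - _ = (2 * (z - y) * z ^+ 2 - y) / (y * z ^+ 3)); last first.
  by field; rewrite !lt0r_neq0.
rewrite divr_ge0 ?mulr_ge0 ?exprn_ge0 ?(ltW y0) ?(ltW z0)//.
have zy : (z - y) * (z + y) = 1 by rewrite -subr_sqr z2; ring.
have zy0 : 0 < z + y by rewrite addr_gt0.
rewrite -(pmulr_lge0 _ zy0) mulrBl.
rewrite (_ : 2 * (z - y) * z ^+ 2 * (z + y) = 2 * z ^+ 2 * ((z - y) * (z + y))); last by ring.
rewrite zy mulr1.
have yz : y <= z.
  by rewrite -ler_sqr ?nnegrE ?(ltW y0) ?(ltW z0)// z2 lerDl.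
by nra.
Qed.

Section pgf_theory.
Context (R : realType) (a : nat -> R) (C : R).
Context (a_ge0 : forall n, 0 <= a n) (a_leC : forall n, a n <= C).

Lemma pgf_fin_num x : 0 < x < 1 -> (\sum_(n <oo) (a n * x ^+ n)%:E)%E \is a fin_num.
Proof.
move=> x01; have /andP[x0 x1] := x01.
apply: (@nneseries_EFin_fin_num _ _ (C * (1 - x)^-1)) => [n|N].
  by rewrite mulr_ge0// exprn_ge0// ltW.
have C0 : 0 <= C by apply: le_trans (a_leC 0%N).
apply: le_trans (ler_wpM2l C0 (sum_geometric_le N x01)).
by rewrite mulr_sumr ler_sum// => n _; rewrite ler_wpM2r// exprn_ge0// ltW.
Qed.

Lemma dpgf_fin_num x : 0 < x < 1 ->
  (\sum_(n <oo) (n%:R * a n * x ^+ n.-1)%:E)%E \is a fin_num.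
Proof.
move=> x01; have /andP[x0 x1] := x01.
apply: (@nneseries_EFin_fin_num _ _ (C * ((1 - x) ^+ 2)^-1)) => [n|N].
  by rewrite !mulr_ge0// exprn_ge0// ltW.
have C0 : 0 <= C by apply: le_trans (a_leC 0%N).
apply: le_trans (ler_wpM2l C0 (sum_dgeometric_le N x01)).
rewrite mulr_sumr ler_sum// => n _; rewrite [leRHS]mulrA ler_wpM2r//.
  by rewrite exprn_ge0// ltW.
by rewrite mulrC ler_wpM2r.
Qed.

Lemma pgfE x : 0 < x < 1 -> (pgf a x)%:E = (\sum_(n <oo) (a n * x ^+ n)%:E)%E.
Proof. by move=> x01; rewrite /pgf fineK// pgf_fin_num. Qed.

Lemma dpgfE x : 0 < x < 1 ->
  (dpgf a x)%:E = (\sum_(n <oo) (n%:R * a n * x ^+ n.-1)%:E)%E.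
Proof. by move=> x01; rewrite /dpgf fineK// dpgf_fin_num. Qed.

Lemma pgf_ge_partial x N : 0 < x < 1 -> \sum_(0 <= n < N) a n * x ^+ n <= pgf a x.
Proof.
move=> x01; have /andP[x0 x1] := x01.
rewrite -lee_fin pgfE// sum_EFin_le_nneseries// => n.
by rewrite mulr_ge0// exprn_ge0// ltW.
Qed.

Lemma dpgf_ge_partial x N : 0 < x < 1 ->
  \sum_(0 <= n < N) n%:R * a n * x ^+ n.-1 <= dpgf a x.
Proof.
move=> x01; have /andP[x0 x1] := x01.
rewrite -lee_fin dpgfE// sum_EFin_le_nneseries// => n.
by rewrite !mulr_ge0// exprn_ge0// ltW.
Qed.

Lemma pgf_le x M : 0 < x < 1 -> (forall N, \sum_(0 <= n < N) a n * x ^+ n <= M) ->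
  pgf a x <= M.
Proof.
move=> x01 h; have /andP[x0 x1] := x01.
rewrite -lee_fin pgfE// nneseries_EFin_le// => n.
by rewrite mulr_ge0// exprn_ge0// ltW.
Qed.

Lemma pgf_gt0 x m : 0 < x < 1 -> 0 < a m -> 0 < pgf a x.
Proof.
move=> x01 am; have /andP[x0 x1] := x01.
apply: lt_le_trans (pgf_ge_partial m.+1 x01).
rewrite big_nat_recr//= ltr_wpDl//; last by rewrite mulr_gt0// exprn_gt0.
by rewrite sumr_ge0// => n _; rewrite mulr_ge0// exprn_ge0// ltW.
Qed.

Let near01 : \forall x \near (1 : R)^'-, 0 < x < 1.
Proof.
near=> x; apply/andP; split; near: x; last exact: nbhs_left_lt.
exact: nbhs_left_gt.
Unshelve. all: by end_near. Qed.

Lemma pgf_at_left : (pgf a x)%:E @[x --> (1 : R)^'-] --> (\sum_(n <oo) (a n)%:E)%E.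
Proof.
apply: cvg_trans (abel_at_left id a_ge0).
apply: near_eq_cvg; near=> x; rewrite pgfE//.
by near: x; exact: near01.
Unshelve. all: by end_near. Qed.

Lemma dpgf_at_left :
  (dpgf a x)%:E @[x --> (1 : R)^'-] --> (\sum_(n <oo) (n%:R * a n)%:E)%E.
Proof.
apply: cvg_trans (abel_at_left predn _); last by move=> n; rewrite mulr_ge0.
apply: near_eq_cvg; near=> x; rewrite dpgfE//.
by near: x; exact: near01.
Unshelve. all: by end_near. Qed.

End pgf_theory.

Lemma near_left1 (R : realType) : \forall x \near (1 : R)^'-, 0 < x < 1.
Proof.
near=> x; apply/andP; split; near: x; last exact: nbhs_left_lt.
exact: nbhs_left_gt.
Unshelve. all: by end_near. Qed.

(** * Limits of the ratios at 1 *)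

Section ratio.
Context (R : realType) (a b : nat -> R) (C : R).
Context (a_ge0 : forall n, 0 <= a n) (a_leC : forall n, a n <= C).
Context (b_ge0 : forall n, 0 <= b n) (b_leC : forall n, b n <= C).
Context (m : nat) (bm_gt0 : 0 < b m).

Lemma ratio_cvg_summable : (\sum_(n <oo) (b n)%:E)%E \is a fin_num ->
  (dpgf a x / (pgf b x * (1 + pgf b x)))%:E @[x --> (1 : R)^'-] -->
  ((\sum_(n <oo) (n%:R * a n)%:E) *
   ((fine (\sum_(n <oo) (b n)%:E) * (1 + fine (\sum_(n <oo) (b n)%:E)))^-1)%:E)%E.
Proof.
move=> bfin; set beta := fine _.
have beta0 : 0 < beta.
  rewrite -lte_fin /beta fineK//.
  apply: lt_le_trans (sum_EFin_le_nneseries m.+1 b_ge0).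
  by rewrite lte_fin big_nat_recr//= ltr_wpDl// sumr_ge0.
have B : pgf b x @[x --> (1 : R)^'-] --> beta.
  have := pgf_at_left b_ge0 b_leC; rewrite -(fineK bfin) => /fine_cvgP[_].
  exact.
have BB : (pgf b x * (1 + pgf b x))^-1 @[x --> (1 : R)^'-] --> (beta * (1 + beta))^-1.
  apply: cvgV; first by rewrite lt0r_neq0// mulr_gt0// ltr_wpDl.
  by apply: cvgM => //; apply: cvgD => //; exact: cvg_cst.
have q0 : 0 < (beta * (1 + beta))^-1 by rewrite invr_gt0 mulr_gt0// ltr_wpDl.
under eq_fun => x do rewrite EFinM.
apply: cvgeM; [|exact: dpgf_at_left a_ge0 a_leC|by apply: cvg_EFin; [exact: nearW|exact: BB]].
(* The product of the limits is defined even if the first is infinite, since the second is a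
   positive real. *)
by case: (\sum_(n <oo) (n%:R * a n)%:E)%E => [r| |] //; rewrite /mule_def gt_eqF.
Qed.

(** Cruder than the logarithmic growth, but the square of 1/t is still small against the order 1/t^3
    that [dpgf_harmonic_ge] gives for the numerator. *)
Lemma pgf_harmonic_le x t : 0 < x < 1 -> 0 < t -> t ^+ 3 = 1 - x ->
  b 0%N = 0 -> (forall n, b n.+1 <= C / n.+1%:R) ->
  pgf b x <= 4 * C / t.
Proof.
move=> x01 t0 tx b0 bn; have /andP[x0 x1] := x01.
have C0 : 0 <= C by apply: le_trans (b_leC 0%N).
apply: (pgf_le b_ge0 b_leC x01) => -[|N].
  by rewrite big_geq// divr_ge0 ?mulr_ge0// ltW.
(* With n for [n.+1]: 1/n is at most t^2 if t sqrt n >= 1, and at most 1/(t n sqrt n) otherwise.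
   Summed, the two parts give t^2/(1 - x) = 1/t and 3/t. *)
have young n : b n.+1 <= C * (t ^+ 2 + (n.+1%:R * Num.sqrt n.+1%:R)^-1 / t).
  apply: le_trans (bn n) _; rewrite ler_wpM2l//.
  set y := Num.sqrt n.+1%:R.
  have y0 : 0 < y by rewrite sqrtr_gt0 ltr0n.
  rewrite (_ : n.+1%:R = y ^+ 2); last by rewrite sqr_sqrtr.
  have [ty|ty] := leP 1 (t * y).
    rewrite ler_wpDr ?divr_ge0 ?invr_ge0 ?mulr_ge0 ?sqr_ge0 ?(ltW t0) ?(ltW y0)//.
    rewrite -[leLHS]div1r ler_pdivrMr ?exprn_gt0// -exprMn.
    by rewrite exprn_ege1.
  rewrite ler_wpDl ?sqr_ge0// -invfM lef_pV2 ?posrE ?mulr_gt0 ?exprn_gt0//.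
  rewrite -[leRHS]mulr1 -mulrA ler_pM2l ?exprn_gt0// mulrC ltW//.
have -> : 4 * C / t = C * (t ^+ 2 * (1 - x)^-1 + 3 / t).
  by rewrite -tx; field; rewrite lt0r_neq0.
rewrite big_nat_recl// b0 mul0r add0r.
apply: (@le_trans _ _ (\sum_(0 <= n < N) C * (t ^+ 2 * x ^+ n + (n.+1%:R * Num.sqrt n.+1%:R)^-1 / t))).
  apply: ler_sum => n _.
  apply: le_trans (ler_wpM2r _ (young n)) _; first by rewrite exprn_ge0// ltW.
  rewrite -mulrA ler_wpM2l// mulrDl lerD//.
    by rewrite ler_wpM2l ?sqr_ge0// exprS ler_piMl ?exprn_ge0 ?ltW.
  rewrite ler_piMr ?exprn_ile1 ?(ltW x0) ?(ltW x1)// divr_ge0 ?invr_ge0 ?mulr_ge0 ?sqrtr_ge0 ?(ltW t0)//.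
rewrite -mulr_sumr ler_wpM2l// big_split/= -mulr_sumr -mulr_suml lerD//.
  by rewrite ler_wpM2l ?sqr_ge0// sum_geometric_le.
by rewrite ler_wpM2r ?invr_ge0 ?(ltW t0)// sum_sqrt3_le.
Qed.

Lemma dpgf_harmonic_ge x c N : 0 < x < 1 -> 0 < c ->
  (forall n, (N <= n)%N -> c <= n%:R * a n) ->
  c * x ^+ N / (1 - x) <= dpgf a x.
Proof.
move=> x01 c0 an; have /andP[x0 x1] := x01.
have geo : series (geometric (c * x ^+ N) x) @ \oo --> c * x ^+ N * (1 - x)^-1.
  by apply: cvg_geometric_series; rewrite ger0_norm// ltW.
apply: cvgr_to_le geo _; apply: nearW => K.
apply: le_trans (dpgf_ge_partial a_ge0 a_leC (N + K) x01).
rewrite (big_cat_nat (n := N)) ?leq_addr//= ler_wpDl//.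
  by rewrite sumr_ge0// => n _; rewrite !mulr_ge0// exprn_ge0// ltW.
rewrite -[X in \sum_(X <= _ < _) _]add0n big_addn addKn /series /=; apply: ler_sum => n _.
have Nn := an (n + N)%N (leq_addl _ _).
rewrite /geometric /= -[leLHS]mulrA -exprD [(N + n)%N]addnC.
apply: ler_pM => //; rewrite ?exprn_ge0 ?(ltW x0) ?(ltW c0)//.
by rewrite ler_wiXn2l ?(ltW x0) ?(ltW x1) ?leq_pred.
Qed.

Lemma ratio_cvg_harmonic c N : 0 < c ->
  (forall n, (N <= n)%N -> c <= n%:R * a n) ->
  b 0%N = 0 -> (forall n, b n.+1 <= C / n.+1%:R) ->
  (dpgf a x / (pgf b x * (1 + pgf b x)))%:E @[x --> (1 : R)^'-] --> +oo%E.
Proof.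
move=> c0 an b0 bn; apply/cvgeyPge => A.
have C0 : 0 < C by apply: lt_le_trans (b_leC m).
pose K := 4 * C * (1 + 4 * C).
have K0 : 0 < K by rewrite !mulr_gt0 ?addr_gt0 ?mulr_gt0.
(* For x >= 1/2 the factor 2^-N bounds x^N from below. K/t^2 will bound the denominator, and t <=
   [del] makes cN/(K t) at least |A| + 1. *)
pose cN := c * 2^-1 ^+ N.
have cN0 : 0 < cN by rewrite mulr_gt0// exprn_gt0// invr_gt0.
pose del := cN / (K * (`|A| + 1)).
have del0 : 0 < del by rewrite divr_gt0// mulr_gt0// ltr_wpDl.
near=> x.
have x01 : 0 < x < 1 by near: x; exact: near_left1.
have xhalf : 2^-1 <= x by near: x; apply: nbhs_left_ge; lra.
have xdel : 1 - x < del ^+ 3 by near: x; apply: nbhs_left_ltBl; rewrite exprn_gt0.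
have /andP[x0 x1] := x01.
pose t := (1 - x) `^ (3%:R^-1).
have t0 : 0 < t by rewrite powR_gt0 ?subr_gt0.
have t3 : t ^+ 3 = 1 - x.
  by rewrite -powR_mulrn ?powR_ge0// -powRrM mulVf ?powRr1 ?subr_ge0 ?(ltW x1)// pnatr_eq0.
have t1 : t <= 1.
  by rewrite -(@ler_pXn2r _ 3) ?nnegrE ?(ltW t0)// t3 expr1n gerBl ltW.
have tdel : t <= del.
  by rewrite -(@ler_pXn2r _ 3) ?nnegrE ?(ltW t0) ?(ltW del0)// t3 ltW.
have B0 := pgf_gt0 b_ge0 b_leC x01 bm_gt0.
have B1 := pgf_harmonic_le x01 t0 t3 b0 bn.
have D1 : cN / t ^+ 3 <= dpgf a x.
  apply: le_trans (dpgf_harmonic_ge x01 c0 an).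
  rewrite t3 ler_wpM2r ?invr_ge0 ?subr_ge0 ?(ltW x1)// ler_wpM2l ?(ltW c0)//.
  by rewrite lerXn2r ?nnegrE ?invr_ge0 ?(ltW x0).
have BK : pgf b x * (1 + pgf b x) <= K / t ^+ 2.
  rewrite (_ : K / t ^+ 2 = (4 * C / t) * ((1 + 4 * C) / t)); last first.
    by rewrite /K; field; rewrite lt0r_neq0.
  apply: ler_pM => //; rewrite ?addr_ge0 ?(ltW B0)//.
  rewrite mulrDl lerD// mul1r invf_ge1//.
rewrite lee_fin ler_pdivlMr; last by rewrite mulr_gt0// addr_gt0.
apply: le_trans D1.
apply: (@le_trans _ _ ((`|A| + 1) * (K / t ^+ 2))).
  have A1 : 0 <= `|A| + 1 by rewrite addr_ge0.
  apply: le_trans (ler_wpM2l A1 BK); rewrite ler_wpM2r//.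
    by rewrite mulr_ge0 ?addr_ge0 ?(ltW B0).
  by rewrite (le_trans (ler_norm _))// lerDl.
have t30 : 0 < t ^+ 3 by rewrite exprn_gt0.
rewrite ler_pdivlMr// [leLHS](_ : _ = t * (K * (`|A| + 1))); last first.
  by field; rewrite lt0r_neq0.
by rewrite -ler_pdivlMr// mulr_gt0// ltr_wpDl.
Unshelve. all: by end_near. Qed.

End ratio.

(** * The coefficient sequences of UB and LB *)

Lemma cvg_sum_fine (R : realType) (s : nat -> R) (m : nat) :
  (forall n, 0 <= s n) -> (\sum_(m <= n <oo) (s n)%:E)%E \is a fin_num ->
  (\sum_(m <= n < k) s n) @[k --> \oo] --> fine (\sum_(m <= n <oo) (s n)%:E)%E.
Proof.
move=> s0 sfin.
have : ((\sum_(m <= n < k) (s n)%:E)%E @[k --> \oo] -->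
    (\sum_(m <= n <oo) (s n)%:E)%E).
  by apply: is_cvg_nneseries => n _ _; rewrite lee_fin.
rewrite -{1}(fineK sfin) => /fine_cvgP[_]; apply: cvg_trans.
by apply: near_eq_cvg; apply: nearW => k; rewrite /= sumEFin.
Qed.

(** Merges the two summands of UB and LB into one series; summability of s makes the limit in
    [tail_sum] exist. *)
Lemma head_tail_sum (R : realType) (s v w : nat -> R) (m : nat) (c : R) :
  (0 < m)%N -> 0 < c -> (forall n, 0 <= s n) -> s 0%N = 0 ->
  (\sum_(n <oo) (s n)%:E)%E \is a fin_num ->
  (forall n, (0 < n < m)%N -> s n = v n) ->
  (forall n, (m <= n)%N -> s n = c * w n) ->
  \sum_(1 <= n < m) v n + c * tail_sum m w = fine (\sum_(n <oo) (s n)%:E)%E.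
Proof.
move=> m0 c0 s0 s00 sfin sv sw.
have sE n : (0 <= (s n)%:E)%E by rewrite lee_fin.
have := sfin; rewrite (nneseries_split 0 m)// add0n sumEFin.
rewrite fin_numD => /andP[_ tfin].
rewrite fineD//=; congr (_ + _).
  rewrite [RHS]big_ltn// s00 add0r; apply: eq_big_nat => n nm.
  by rewrite sv.
have -> : tail_sum m w = c^-1 * fine (\sum_(m <= n <oo) (s n)%:E)%E.
  apply: cvg_lim => //.
  rewrite (_ : (fun k => _) = (fun k => c^-1 * \sum_(m <= n < k) s n)).
    by apply: cvgM; [exact: cvg_cst|exact: cvg_sum_fine].
  apply/funext => k; rewrite mulr_sumr; apply: eq_big_nat => n /andP[mn _].
  by rewrite sw// mulKf// lt0r_neq0.
by rewrite mulVKf// lt0r_neq0.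
Qed.

(** UB, LB and their derivative versions are generating functions of such sequences; the value at 0
    is 0 because their sums start at n = 1. *)
Definition hybrid (R : realType) (m : nat) (c : R) (r w : nat -> R) (n : nat) : R :=
  if n == 0%N then 0 else if (n < m)%N then r n else c * w n.

Section hybrid_theory.
Context (R : realType) (m : nat) (c : R) (r w : nat -> R).
Context (m0 : (0 < m)%N) (c0 : 0 < c).
Context (r_ge0 : forall n, 0 <= r n) (r_le1 : forall n, r n <= 1).
Context (w_gt0 : forall n, 0 < w n.+1) (w_le : forall n, w n.+1 <= n.+1%:R^-1).

Lemma hybrid_ge0 n : 0 <= hybrid m c r w n.
Proof.
rewrite /hybrid; case: n => [//|n] /=; case: ifP => // _.
by rewrite mulr_ge0// ltW.
Qed.

Lemma hybrid_harmonic n : hybrid m c r w n.+1 <= (m%:R + c) / n.+1%:R.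
Proof.
have n0 : 0 < n.+1%:R :> R by rewrite ltr0n.
rewrite /hybrid /=; case: ifP => [nm|_].
  rewrite (le_trans (r_le1 _))// ler_pdivlMr// mul1r.
  by rewrite (le_trans _ (_ : m%:R <= _))// ?ler_nat ?(ltnW nm)// lerDl ltW.
apply: le_trans (ler_wpM2l (ltW c0) (w_le n)) _.
by rewrite ler_wpM2r ?invr_ge0// lerDr.
Qed.

Lemma hybrid_leC n : hybrid m c r w n <= m%:R + c.
Proof.
have mc : 0 <= m%:R + c by rewrite addr_ge0// ltW.
case: n => [//|n]; apply: le_trans (hybrid_harmonic n) _.
by rewrite ler_pdivrMr// ler_peMr// ler1n.
Qed.

Lemma hybrid_gt0 : 0 < hybrid m c r w m.
Proof. by rewrite /hybrid ltnn gtn_eqF// mulr_gt0// -(prednK m0). Qed.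

Lemma hybrid_summable (M : R) :
  (forall N, \sum_(0 <= n < N) w n.+1 <= M) ->
  (\sum_(n <oo) (hybrid m c r w n)%:E)%E \is a fin_num.
Proof.
move=> wM; apply: (@nneseries_EFin_fin_num _ _ (m%:R + c * M)) => [|[|N]].
- exact: hybrid_ge0.
- rewrite big_geq// addr_ge0// mulr_ge0 ?(ltW c0)//.
  by have := wM 0%N; rewrite big_geq.
rewrite big_nat_recl// {1}/hybrid /= add0r.
apply: (@le_trans _ _ (\sum_(0 <= n < N) ((n.+1 < m)%N%:R + c * w n.+1))).
  apply: ler_sum => n _; rewrite /hybrid /=.
  case: ifP => _; last by rewrite add0r.
  by rewrite (le_trans (r_le1 _))// lerDl mulr_ge0// ltW.
rewrite big_split/= -mulr_sumr lerD// ?ler_wpM2l ?(ltW c0)//.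
(* What remains counts the indices of the head, at most m of them. *)
rewrite -natr_sum ler_nat.
elim: N {wM} m => [|N IH] k; first by rewrite big_geq.
rewrite big_nat_recl//; case: k => [|k].
  by rewrite big1.
exact: leq_add (leq_b1 _) (IH k).
Qed.

End hybrid_theory.

Section coeff.
Context (R : realType) (d : nat) (p : 'I_d -> R).
Context (d3 : (3 <= d)%N) (p01 : forall j, 0 < p j < 1).

Definition rate (n : nat) : R := npow n ((d%:R - 1) / 2) * TT p ^+ n.

Let d0 : (0 < d)%N. Proof. exact: leq_trans d3. Qed.

Let dE : d%:R - 1 = d.-1%:R :> R.
Proof. by rewrite -{1}(prednK d0) -natr1 addrK. Qed.

Lemma rate_gt0 n : 0 < rate n.+1.
Proof. by rewrite mulr_gt0 ?exprn_gt0 ?TT_gt0// powR_gt0. Qed.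

Lemma rate_le n k : (k <= d.-1)%N ->
  rate n.+1 <= (Num.sqrt n.+1%:R ^+ k)^-1 * TT p ^+ n.+1.
Proof.
move=> kd; rewrite /rate dE npow_half ler_wpM2r ?exprn_ge0 ?(ltW (TT_gt0 p01))//.
have s1 : 1 <= Num.sqrt n.+1%:R :> R by rewrite -[leLHS]sqrtr1 ler_wsqrtr// ler1n.
have s0 := lt_le_trans ltr01 s1.
by rewrite lef_pV2 ?posrE ?exprn_gt0// ler_weXn2l.
Qed.

Let TTn n : TT p ^+ n <= 1.
Proof. by rewrite exprn_ile1 ?TT_le1 ?(ltW (TT_gt0 p01)). Qed.

Lemma rate_le_harmonic n : rate n.+1 <= n.+1%:R^-1.
Proof.
apply: le_trans (@rate_le n 2 _) _; first by rewrite -ltnS prednK.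
by rewrite sqr_sqrtr// ler_piMr// invr_ge0.
Qed.

(** Differentiation multiplies the coefficients by n, which lowers the exponent by one. *)
Lemma mulr_npow n : (0 < n)%N ->
  n%:R * npow n ((d%:R - 1) / 2) = npow n ((d%:R - 3) / 2) :> R.
Proof.
move=> n0; rewrite /npow (_ : - ((d%:R - 3) / 2) = 1 + - ((d%:R - 1) / 2)); last by lra.
rewrite powRD ?powRr1//; apply/implyP => _.
by rewrite pnatr_eq0 -lt0n.
Qed.

(** A geometric series if T < 1; if T = 1 and d >= 4, the exponent (d - 1)/2 is at least 3/2. *)
Lemma rate_summable : ~~ ((d == 3%N) && (TT p == 1)) ->
  exists M, forall N, \sum_(0 <= n < N) rate n.+1 <= M.
Proof.
have T0 := TT_gt0 p01.
have [T1|T1] := eqVneq (TT p) 1; last first.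
  move=> _; exists (1 - TT p)^-1 => N.
  have T01 : 0 < TT p < 1 by rewrite T0 lt_neqAle T1 TT_le1.
  apply: le_trans (sum_geometric_le N T01).
  apply: ler_sum => n _; apply: le_trans (@rate_le n 0 _) _ => //.
  by rewrite expr0 invr1 mul1r ler_wiXn2l ?(ltW T0) ?TT_le1.
rewrite andbT => d3'; exists 3 => N.
apply: le_trans (sum_sqrt3_le R N); apply: ler_sum => n _.
have d4 : (3 <= d.-1)%N by rewrite -ltnS prednK// ltn_neqAle eq_sym d3'.
apply: le_trans (rate_le n d4) _.
by rewrite exprS sqr_sqrtr// T1 expr1n mulr1 mulrC.
Qed.

Lemma rate_critical n : d = 3%N -> TT p = 1 -> rate n.+1 = n.+1%:R^-1.
Proof.
move=> dd T1; rewrite /rate dE npow_half T1 expr1n mulr1.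
by rewrite (_ : d.-1 = 2%N) ?dd// sqr_sqrtr.
Qed.

Context (m : nat) (c : R) (m0 : (0 < m)%N) (c0 : 0 < c).

Let h := hybrid m c (rr p) rate.
Let r_ge0 := rr_ge0 d0 p01.
Let r_le1 := rr_le1 d0 p01.

Let h_ge0 := hybrid_ge0 m c0 r_ge0 rate_gt0.
Let h_leC := hybrid_leC m c0 r_le1 rate_le_harmonic.

Lemma pgf_hybridE x : 0 < x < 1 ->
  \sum_(1 <= n < m) rr p n * x ^+ n +
  c * tail_sum m (fun n => npow n ((d%:R - 1) / 2) * (TT p * x) ^+ n) = pgf h x.
Proof.
move=> x01; have /andP[x0 x1] := x01.
apply: head_tail_sum => //.
- by move=> n; rewrite mulr_ge0 ?exprn_ge0 ?(ltW x0)//; exact: h_ge0.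
- by rewrite mul0r.
- exact: (pgf_fin_num h_ge0 h_leC).
- by move=> n /andP[n0 nm]; rewrite /h /hybrid gtn_eqF// nm.
- move=> n mn; rewrite /h /hybrid gtn_eqF ?(leq_trans m0)// ltnNge mn /= /rate.
  by rewrite [(TT p * x) ^+ n]exprMn -!mulrA.
Qed.

Lemma dpgf_hybridE x : 0 < x < 1 ->
  \sum_(1 <= n < m) n%:R * rr p n * x ^+ n.-1 +
  c * tail_sum m (fun n => npow n ((d%:R - 3) / 2) * x^-1 * (TT p * x) ^+ n) =
  dpgf h x.
Proof.
move=> x01; have /andP[x0 x1] := x01.
apply: head_tail_sum => //.
- by move=> n; rewrite !mulr_ge0 ?exprn_ge0 ?(ltW x0)//; exact: h_ge0.
- by rewrite !mul0r.
- exact: (dpgf_fin_num h_ge0 h_leC).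
- by move=> n /andP[n0 nm]; rewrite /h /hybrid gtn_eqF// nm.
- move=> n mn; have n0 := leq_trans m0 mn.
  rewrite /h /hybrid gtn_eqF// ltnNge mn /= -mulr_npow// /rate.
  have xn : x ^+ n = x * x ^+ n.-1 by rewrite -exprS prednK.
  rewrite [(TT p * x) ^+ n]exprMn xn.
  by field; rewrite lt0r_neq0.
Qed.

End coeff.

Lemma ratio_hybrid_cvg (R : realType) (d : nat) (p : 'I_d -> R)
    (m1 m2 : nat) (c1 c2 : R) :
  (3 <= d)%N -> (forall j, 0 < p j < 1) ->
  (0 < m1)%N -> (0 < m2)%N -> 0 < c1 -> 0 < c2 ->
  let a := hybrid m1 c1 (rr p) (rate p) in
  let b := hybrid m2 c2 (rr p) (rate p) in
  exists L : \bar R,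
    (dpgf a x / (pgf b x * (1 + pgf b x)))%:E @[x --> (1 : R)^'-] --> L.
Proof.
move=> d3 p01 m10 m20 c10 c20 a b.
have d0 : (0 < d)%N by exact: leq_trans d3.
have r_ge0 := rr_ge0 d0 p01; have r_le1 := rr_le1 d0 p01.
have w_gt0 := rate_gt0 p01; have w_le := rate_le_harmonic d3 p01.
pose C := (m1%:R + c1) + (m2%:R + c2).
have C1 : m1%:R + c1 <= C by rewrite lerDl addr_ge0// ltW.
have C2 : m2%:R + c2 <= C by rewrite lerDr addr_ge0// ltW.
have a0 : forall n, 0 <= a n by exact: hybrid_ge0.
have b0 : forall n, 0 <= b n by exact: hybrid_ge0.
have aC n : a n <= C by apply: le_trans C1; exact: hybrid_leC.
have bC n : b n <= C by apply: le_trans C2; exact: hybrid_leC.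
have bm : 0 < b m2 by exact: hybrid_gt0.
have [/andP[/eqP dd /eqP T1]|/(rate_summable d3 p01)[M wM]] :=
  boolP ((d == 3%N) && (TT p == 1)).
  (* Here the rate is exactly 1/n, so n times [a n] equals c1 from m1 on. *)
  exists +oo%E; apply: (ratio_cvg_harmonic a0 aC b0 bC bm (c := c1) (N := m1)) => //.
    move=> n mn; have n0 := leq_trans m10 mn.
    rewrite /a /hybrid gtn_eqF// ltnNge mn /= -(prednK n0) rate_critical//.
    by rewrite mulrC divfK// pnatr_eq0.
  move=> n; apply: le_trans (_ : (m2%:R + c2) / n.+1%:R <= _).
    exact: hybrid_harmonic.
  by rewrite ler_wpM2r// invr_ge0.
eexists; apply: (ratio_cvg_summable a0 aC b0 bC bm).
exact: hybrid_summable wM.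
Qed.

(** * Monotonicity of the ratio in the coefficients *)

Lemma pgf_mono (R : realType) (a b : nat -> R) (C x : R) :
  (forall n, 0 <= a n) -> (forall n, a n <= b n) -> (forall n, b n <= C) ->
  0 < x < 1 -> pgf a x <= pgf b x.
Proof.
move=> a0 ab bC x01; have /andP[x0 x1] := x01.
have b0 n : 0 <= b n := le_trans (a0 n) (ab n).
have aC n : a n <= C := le_trans (ab n) (bC n).
rewrite -lee_fin (pgfE a0 aC)// (pgfE b0 bC)//.
by apply: lee_nneseries => n *; rewrite lee_fin ?mulr_ge0 ?ler_wpM2r ?exprn_ge0 ?(ltW x0).
Qed.

Lemma dpgf_mono (R : realType) (a b : nat -> R) (C x : R) :
  (forall n, 0 <= a n) -> (forall n, a n <= b n) -> (forall n, b n <= C) ->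
  0 < x < 1 -> dpgf a x <= dpgf b x.
Proof.
move=> a0 ab bC x01; have /andP[x0 x1] := x01.
have b0 n : 0 <= b n := le_trans (a0 n) (ab n).
have aC n : a n <= C := le_trans (ab n) (bC n).
rewrite -lee_fin (dpgfE a0 aC)// (dpgfE b0 bC)//.
by apply: lee_nneseries => n *; rewrite lee_fin ?mulr_ge0 ?ler_wpM2r ?ler_wpM2l ?exprn_ge0 ?(ltW x0).
Qed.

Lemma ratio_le (R : realType) (a1 b1 a2 b2 : nat -> R) (C1 C2 x : R) (m : nat) :
  (forall n, 0 <= a1 n) -> (forall n, a1 n <= a2 n) -> (forall n, a2 n <= C1) ->
  (forall n, 0 <= b2 n) -> (forall n, b2 n <= b1 n) -> (forall n, b1 n <= C2) ->
  0 < b2 m -> 0 < x < 1 ->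
  dpgf a1 x / (pgf b1 x * (1 + pgf b1 x)) <= dpgf a2 x / (pgf b2 x * (1 + pgf b2 x)).
Proof.
move=> a10 a12 a2C b20 b21 b1C bm x01.
have B2 := pgf_gt0 b20 (fun n => le_trans (b21 n) (b1C n)) x01 bm.
have B21 := pgf_mono b20 b21 b1C x01.
have B1 := lt_le_trans B2 B21.
have A12 := dpgf_mono a10 a12 a2C x01.
have A1 : 0 <= dpgf a1 x.
  by have := dpgf_ge_partial a10 (fun n => le_trans (a12 n) (a2C n)) 0 x01; rewrite big_geq.
apply: ler_pM => //; first by rewrite invr_ge0 mulr_ge0 ?addr_ge0 ?(ltW B1).
rewrite lef_pV2 ?posrE ?mulr_gt0 ?addr_gt0//.
by rewrite ler_pM ?addr_ge0 ?(ltW B2)// lerD2l.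
Qed.

(** * Generating functions of a renewal sequence *)

Section renewal_gf.
Context (R : realType) (f u : nat -> R).
Context (f_ge0 : forall n, 0 <= f n) (u_ge0 : forall n, 0 <= u n).
Context (u_le1 : forall n, u n <= 1) (u0 : u 0%N = 1) (f0 : f 0%N = 0).
Context (renew : forall n, (0 < n)%N -> u n = \sum_(k < n) f k.+1 * u (n - k.+1)%N).

(** The coefficients of phi; the extra term [u 0 = 1] of u accounts for the factor 1 + phi. *)
Let v n := if n == 0%N then 0 else u n.

Let v_ge0 n : 0 <= v n. Proof. by rewrite /v; case: ifP. Qed.

Let v_le1 n : v n <= 1. Proof. by rewrite /v; case: ifP. Qed.

Let f_le_v n : f n <= v n.
Proof.
case: n => [|n]; first by rewrite f0.
(* The last term of the renewal equation is [f n.+1 * u 0], and the others are nonnegative. *)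
rewrite /v /= renew// big_ord_recr/= subnn u0 mulr1 lerDr sumr_ge0// => k _.
by rewrite mulr_ge0.
Qed.

Let f_le1 n : f n <= 1. Proof. exact: le_trans (f_le_v n) (v_le1 n). Qed.

Let vE n : v n = \sum_(k < n.+1) f k * u (n - k)%N.
Proof.
case: n => [|n]; first by rewrite big_ord1 f0 mul0r.
by rewrite big_ord_recl f0 mul0r add0r /v /= renew.
Qed.

Section at_x.
Context (x : R) (x01 : 0 < x < 1).

Let x_ge0 : 0 <= x. Proof. by have /andP[/ltW] := x01. Qed.

Let fx n := f n * x ^+ n.
Let ux n := u n * x ^+ n.
Let fx_ge0 n : 0 <= fx n. Proof. by rewrite mulr_ge0 ?exprn_ge0. Qed.
Let ux_ge0 n : 0 <= ux n. Proof. by rewrite mulr_ge0 ?exprn_ge0. Qed.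

Let pgf_u : pgf u x = 1 + pgf v x.
Proof.
apply: EFin_inj; rewrite EFinD (pgfE u_ge0 u_le1)// (pgfE v_ge0 v_le1)//.
rewrite nneseries_recl//; last by move=> n _; rewrite lee_fin ux_ge0.
rewrite u0 mul1r expr0; congr (_ + _)%E.
rewrite [RHS]nneseries_recl//; last first.
  by move=> n _; rewrite lee_fin mulr_ge0 ?exprn_ge0.
rewrite mul0r add0e; apply: congr_lim; apply/funext => k.
apply: eq_big_nat => n /andP[n0 _].
by rewrite /v gtn_eqF.
Qed.

Lemma renewal_pgf : pgf v x = pgf f x * (1 + pgf v x).
Proof.
rewrite -pgf_u; apply: EFin_inj.
rewrite EFinM (pgfE v_ge0 v_le1)// (pgfE f_ge0 f_le1)// (pgfE u_ge0 u_le1)//.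
rewrite -nneseries_cauchy//; last exact: (pgf_fin_num u_ge0 u_le1).
apply: eq_eseriesr => n _; congr (_%:E).
rewrite vE mulr_suml; apply: eq_bigr => k _.
rewrite -[in x ^+ n](subnKC (ltn_ord k : (k <= n)%N)) exprD; ring.
Qed.

(** The product rule, obtained coefficientwise from n = k + (n - k) without differentiating any
    series. *)
Lemma renewal_dpgf :
  dpgf v x = dpgf f x * (1 + pgf v x) + pgf f x * dpgf v x.
Proof.
have dvu : dpgf v x = dpgf u x.
  rewrite /dpgf; congr fine; apply: eq_eseriesr => n _.
  by rewrite /v; case: eqP => // ->; rewrite !mul0r.
rewrite -pgf_u {2}dvu; apply: EFin_inj.
rewrite EFinD !EFinM (dpgfE v_ge0 v_le1)// (dpgfE f_ge0 f_le1)//.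
rewrite (pgfE f_ge0 f_le1)// (pgfE u_ge0 u_le1)// (dpgfE u_ge0 u_le1)//.
have dfx_ge0 n : 0 <= n%:R * f n * x ^+ n.-1 by rewrite !mulr_ge0 ?exprn_ge0.
have dux_ge0 n : 0 <= n%:R * u n * x ^+ n.-1 by rewrite !mulr_ge0 ?exprn_ge0.
rewrite -!nneseries_cauchy//; first last.
- exact: (pgf_fin_num u_ge0 u_le1).
- exact: (dpgf_fin_num u_ge0 u_le1).
rewrite -nneseriesD; first last.
- by move=> n _ _; rewrite lee_fin sumr_ge0// => k _; rewrite mulr_ge0 ?fx_ge0.
- by move=> n _ _; rewrite lee_fin sumr_ge0// => k _; rewrite mulr_ge0 ?ux_ge0.
apply: eq_eseriesr => n _; rewrite -EFinD; congr (_%:E).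
rewrite vE -big_split mulr_sumr mulr_suml; apply: eq_bigr => k _ /=.
(* Multiplying by x removes the predecessors from the exponents. *)
have dx i : i%:R * x ^+ i = i%:R * x ^+ i.-1 * x.
  by case: i => [|i]; rewrite ?mul0r// exprSr mulrA.
have xn : x != 0 by rewrite lt0r_neq0//; have /andP[] := x01.
apply: (mulIf xn); rewrite mulrDl.
have kn := subnKC (ltn_ord k : (k <= n)%N).
set i := (n - k)%N in kn *.
transitivity (f k * u i * (n%:R * x ^+ n)); first by rewrite dx; ring.
transitivity (f k * u i * ((k%:R * x ^+ k) * x ^+ i + x ^+ k * (i%:R * x ^+ i))).
  have -> : n%:R * x ^+ n = (k + i)%:R * x ^+ (k + i) by rewrite kn.
  by rewrite natrD exprD; ring.
by rewrite !dx; ring.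
Qed.

Lemma renewal_ratio m : 0 < v m ->
  dpgf v x / (pgf v x * (1 + pgf v x)) = dpgf f x / pgf f x.
Proof.
move=> vm; have := renewal_pgf; have := renewal_dpgf.
have := pgf_gt0 v_ge0 v_le1 x01 vm.
set V := pgf v x; set F := pgf f x; set D := dpgf v x; set G := dpgf f x.
move=> V0 DE VE.
have V1 : 0 < 1 + V by rewrite addr_gt0.
have F0 : 0 < F by rewrite -(pmulr_lgt0 _ V1) -VE.
(* From 1/(1 - F) = 1 + V follow D = G (1 + V)^2 and V (1 + V) = F (1 + V)^2, and the square
   cancels. *)
have F1 : (1 - F) * (1 + V) = 1 by rewrite mulrBl -VE; ring.
have DG : D = G * (1 + V) ^+ 2.
  rewrite -[LHS]mul1r -{1}F1 mulrAC [(1 - F) * D](_ : _ = G * (1 + V)).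
    by ring.
  by rewrite mulrBl mul1r {1}DE addrK.
have -> : V * (1 + V) = F * (1 + V) ^+ 2 by rewrite {1}VE; ring.
by rewrite DG; field; rewrite !lt0r_neq0.
Qed.

End at_x.

Lemma renewal_pgf_le1 x : 0 < x < 1 -> pgf f x <= 1.
Proof.
move=> x01; have V0 : 0 <= pgf v x.
  by have := pgf_ge_partial v_ge0 v_le1 0 x01; rewrite big_geq.
have V1 : 0 < 1 + pgf v x by rewrite ltr_wpDr.
by rewrite -(ler_pM2r V1) -renewal_pgf// mul1r lerDr.
Qed.

(** The bound F <= 1 on (0, 1) passes to the limit by Abel's theorem. *)
Lemma renewal_fin_num : (\sum_(n <oo) (f n)%:E)%E \is a fin_num.
Proof.
rewrite ge0_fin_numE ?nneseries_EFin_ge0//.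
apply: (@le_lt_trans _ _ 1%E); last exact: ltry.
apply: cvge_to_le (pgf_at_left f_ge0 f_le1) _.
near=> x; rewrite lee_fin renewal_pgf_le1//.
by near: x; exact: near_left1.
Unshelve. all: by end_near. Qed.

(** Abel's theorem for numerator and denominator; the former may tend to infinity, the latter has a
    finite limit, positive because of [f m]. *)
Lemma renewal_mean_at_left m : 0 < f m ->
  (dpgf f x / pgf f x)%:E @[x --> (1 : R)^'-] -->
  (\sum_(1 <= n <oo) (n%:R * f n / limn (series f))%:E)%E.
Proof.
move=> fm.
have Fl : limn (series f) = fine (\sum_(n <oo) (f n)%:E)%E.
  by apply: cvg_lim => //; exact: (cvg_sum_fine f_ge0 renewal_fin_num).
set S := limn _ in Fl *.
have S0 : 0 < S.
  rewrite -lte_fin Fl fineK ?renewal_fin_num//.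
  apply: lt_le_trans (sum_EFin_le_nneseries m.+1 f_ge0).
  by rewrite lte_fin big_nat_recr//= ltr_wpDl// sumr_ge0.
have -> : (\sum_(1 <= n <oo) (n%:R * f n / S)%:E =
    (\sum_(n <oo) (n%:R * f n)%:E) * (S^-1)%:E)%E.
  rewrite muleC -nneseriesZl; last by move=> n _; rewrite lee_fin mulr_ge0.
  rewrite [RHS]nneseries_recl//; last first.
    by move=> n _; rewrite lee_fin mulr_ge0 ?mulr_ge0// invr_ge0 ltW.
  rewrite mul0r mule0 add0e; apply: congr_lim; apply/funext => k.
  by apply: eq_bigr => n _; rewrite -EFinM mulrC.
under eq_fun => x do rewrite EFinM.
apply: cvgeM; [|exact: dpgf_at_left f_ge0 f_le1|].
  by case: (\sum_(n <oo) (n%:R * f n)%:E)%E => [r| |] //; rewrite /mule_def gt_eqF ?invr_gt0.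
apply: cvg_EFin; first exact: nearW.
apply: cvgV; first by rewrite lt0r_neq0.
have := pgf_at_left f_ge0 f_le1; rewrite -(fineK renewal_fin_num) -Fl.
by move=> /fine_cvgP[_].
Qed.

End renewal_gf.

(** * Comparison of the bounds with the conditional mean *)

Lemma rencontre_bounds_le (R : realType) (d : nat) (p : 'I_d -> R)
    (m1 m2 : nat) (c1 c2 : R) (Lu Ll : \bar R) :
  (3 <= d)%N -> (forall j, 0 < p j < 1) ->
  (0 < m1)%N -> (0 < m2)%N -> 0 < c1 -> 0 < c2 ->
  (forall n, (m1 <= n)%N -> rr p n <= c1 * rate p n) ->
  (forall n, (m2 <= n)%N -> c2 * rate p n <= rr p n) ->
  let a := hybrid m1 c1 (rr p) (rate p) in
  let b := hybrid m2 c2 (rr p) (rate p) in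
  (dpgf a x / (pgf b x * (1 + pgf b x)))%:E @[x --> (1 : R)^'-] --> Lu ->
  (dpgf b x / (pgf a x * (1 + pgf a x)))%:E @[x --> (1 : R)^'-] --> Ll ->
  (Ll <= cond_mean_J p <= Lu)%E.
Proof.
move=> d3 p01 m10 m20 c10 c20 up low a b aL bL.
have d0 : (0 < d)%N by exact: leq_trans d3.
have r_ge0 := rr_ge0 d0 p01; have r_le1 := rr_le1 d0 p01.
have w_gt0 := rate_gt0 p01; have w_le := rate_le_harmonic d3 p01.
have peq n : prob_all_equal p n = rr p n.
  by rewrite prob_all_equalE// => j; have /andP[] := p01 j.
have r0 : rr p 0 = 1 by rewrite /rr expr0 mul1r big_ord1 /= bin0 expr1n expr0 mulr1.
have renew n : (0 < n)%N -> rr p n = \sum_(k < n) prob_J p k.+1 * rr p (n - k.+1)%N.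
  by move=> n0; rewrite -peq renewal//; apply: eq_bigr => k _; rewrite peq.
have f_ge0 n : 0 <= prob_J p n by exact: prob_J_ge0.
have f0 := prob_J0 p.
(* The coefficients of phi, which lie between those of b and a. *)
pose v n := if n == 0%N then 0 else rr p n.
have v_ge0 n : 0 <= v n by rewrite /v; case: ifP.
have a_ge0 : forall n, 0 <= a n by exact: hybrid_ge0.
have b_ge0 : forall n, 0 <= b n by exact: hybrid_ge0.
have aC : forall n, a n <= m1%:R + c1 by exact: hybrid_leC.
have vC n : v n <= 1 by rewrite /v; case: ifP.
have va n : v n <= a n.
  rewrite /v /a /hybrid; case: eqP => // _; case: ltnP => // mn.
  exact: up.
have bv n : b n <= v n.
  rewrite /v /b /hybrid; case: eqP => // _; case: ltnP => // mn.
  exact: low.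
have bm : 0 < b m2 by exact: hybrid_gt0.
have vm : 0 < v m2 by apply: lt_le_trans bm (bv _).
(* A rencontre at time 1 has positive probability, so the event that J is finite can be conditioned
   on. *)
have f1 : 0 < prob_J p 1.
  have := renew 1%N isT; rewrite big_ord1 /= subnn r0 mulr1 => <-.
  rewrite rrE// mulr_gt0 ?exprn_gt0 ?TT_gt0//.
  have a0 := alpha_gt0 p01.
  rewrite big_ord_recl ltr_wpDr//.
    by rewrite sumr_ge0// => k _; rewrite exprn_ge0// odds_pmf_ge0 ?ltW.
  by rewrite exprn_gt0// /odds_pmf bin0 expr0 mul1r divr_gt0 ?exprn_gt0 ?addr_gt0.
have mean := renewal_mean_at_left f_ge0 r_ge0 r_le1 r0 f0 renew f1.
rewrite -/(prob_J_finite p) -/(cond_mean_J p) in mean.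
have ratioE x : 0 < x < 1 ->
    dpgf (prob_J p) x / pgf (prob_J p) x = dpgf v x / (pgf v x * (1 + pgf v x)).
  by move=> x01; rewrite (renewal_ratio f_ge0 r_ge0 r_le1 r0 f0 renew x01 vm).
have lim_le (g1 g2 : R -> \bar R) L1 L2 : g1 x @[x --> (1 : R)^'-] --> L1 ->
    g2 x @[x --> (1 : R)^'-] --> L2 ->
    (forall x, 0 < x < 1 -> (g1 x <= g2 x)%E) -> (L1 <= L2)%E.
  move=> g1L g2L g12; rewrite -(cvg_lim _ g1L)// -(cvg_lim _ g2L)//.
  apply: lee_lim; [by apply/cvg_ex; exists L1|by apply/cvg_ex; exists L2|].
  by near=> x; apply: g12; near: x; exact: near_left1.
apply/andP; split.
- apply: lim_le bL mean _ => x x01; rewrite lee_fin ratioE//.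
  exact: (ratio_le b_ge0 bv vC v_ge0 va aC vm x01).
- apply: lim_le mean aL _ => x x01; rewrite lee_fin ratioE//.
  exact: (ratio_le v_ge0 va aC b_ge0 bv vC bm x01).
Unshelve. all: by end_near. Qed.

Theorem theorem16 (R : realType) (d : nat) (p : 'I_d -> R) (l1 l2 : R) :
  (3 <= d)%N ->
  (forall j, 0 < p j < 1) ->
  0 < l1 < 1 -> 0 < l2 < 1 ->
  (exists Lu : \bar R,
     ((UB_dphi p x l1 / (LB_phi p x l2 * (1 + LB_phi p x l2)))%:E
        @[x --> (1 : R)^'-] --> Lu) /\
     (cond_mean_J p <= Lu)%E) /\
  (exists Ll : \bar R,
     ((LB_dphi p x l2 / (UB_phi p x l1 * (1 + UB_phi p x l1)))%:E
        @[x --> (1 : R)^'-] --> Ll) /\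
     (Ll <= cond_mean_J p)%E).
Proof.
move=> d3 p01 l101 l201.
have d0 : (0 < d)%N by exact: leq_trans d3.
have a0 := alpha_gt0 p01.
have [l10 l11] := andP l101; have [l20 l21] := andP l201.
set m1 := Nbound (alpha p) l1; set m2 := Lbound (alpha p) l2.
have m10 : (0 < m1)%N by rewrite leq_max.
have m20 : (0 < m2)%N by rewrite leq_max.
pose c1 := (Mbound (alpha p) l1 / Num.sqrt (2 * pi)) ^+ d.-1.
pose c2 := (Num.sqrt (2 * pi) / expR 2) ^+ d * Kconst (alpha p) d l2.
have s0 : 0 < Num.sqrt (2 * pi) :> R by rewrite sqrtr_gt0 mulr_gt0 ?pi_gt0.
have c10 : 0 < c1.
  rewrite exprn_gt0// !divr_gt0// ?addr_gt0// mulr_gt0 ?sqrtr_gt0//.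
  by rewrite subr_gt0.
have c20 : 0 < c2.
  have max0 m : 0 < Num.max 4 m :> R by rewrite lt_max ltr0n.
  rewrite mulr_gt0 ?exprn_gt0 ?divr_gt0 ?expR_gt0//.
  have w0 : 0 < ((1 - l2) * alpha p + 1) / (alpha p + 1).
    by rewrite divr_gt0 ?addr_gt0 ?mulr_gt0 ?subr_gt0.
  by rewrite addr_gt0 ?(mulr_gt0 w0) ?exprn_gt0 ?mulr_gt0 ?expR_gt0.
have up n : (m1 <= n)%N -> rr p n <= c1 * rate p n by exact: rr_le.
have low n : (m2 <= n)%N -> c2 * rate p n <= rr p n by exact: rr_ge.
have [Lu LuE] := ratio_hybrid_cvg d3 p01 m10 m20 c10 c20.
have [Ll LlE] := ratio_hybrid_cvg d3 p01 m20 m10 c20 c10.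
have /andP[LlJ JLu] := rencontre_bounds_le d3 p01 m10 m20 c10 c20 up low LuE LlE.
(* On (0, 1) the four functions of the statement are generating functions of the two hybrid
   sequences, which suffices for limits at 1 from the left. *)
have UBE x : 0 < x < 1 -> UB_phi p x l1 = pgf (hybrid m1 c1 (rr p) (rate p)) x.
  exact: pgf_hybridE.
have LBE x : 0 < x < 1 -> LB_phi p x l2 = pgf (hybrid m2 c2 (rr p) (rate p)) x.
  exact: pgf_hybridE.
have dUBE x : 0 < x < 1 -> UB_dphi p x l1 = dpgf (hybrid m1 c1 (rr p) (rate p)) x.
  exact: dpgf_hybridE.
have dLBE x : 0 < x < 1 -> LB_dphi p x l2 = dpgf (hybrid m2 c2 (rr p) (rate p)) x.
  exact: dpgf_hybridE.
split; [exists Lu|exists Ll]; split => //.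
- apply: cvg_trans LuE; apply: near_eq_cvg; near=> x.
  have x01 : 0 < x < 1 by near: x; exact: near_left1.
  by rewrite dUBE// LBE.
- apply: cvg_trans LlE; apply: near_eq_cvg; near=> x.
  have x01 : 0 < x < 1 by near: x; exact: near_left1.
  by rewrite dLBE// UBE.
Unshelve. all: by end_near. Qed.
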